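(* Let $e(\Gamma,\omega)$ be an electrical network with $n$ boundary vertices and response matrix $M_R=(x_{ij})$, and let $S$ be any $n\times n$ matrix with $x_{1k}=S_{k1}-S_{kn}$ and $x_{rk}=S_{kr}-S_{k,r-1}$ for $2\le r\le n$, $1\le k\le n$. Then the point of $Gr_{\ge0}(n+1,2n)$ defined by the Postnikov network $PN(\Gamma,\omega',O_2)$ (the row space of its extended boundary measurement matrix $M_B$) is the row space of $X=MD$, where $M$ is the $(n+1)\times 2n$ matrix with first row $(0,1,0,1,\dots,0,1)$ and row $k+1$ ($1\le k\le n$) having entry $1$ in column $2k-1$, $0$ in the other odd columns and $S_{kj}$ in column $2j$, and $D=\mathrm{diag}(1,1,-1,-1,1,1,\dots)$ (entries $(-1)^{j+1}$ at positions $2j-1,2j$).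
   Context: An electrical network $e(\Gamma,\omega)$: a finite planar graph embedded in a disk with boundary vertices $\bar1,\dots,\bar n$ clockwise on the boundary and positive conductances; $M_R$ is its (symmetric) response matrix. Dual generalized Temperley construction $N^d(\Gamma,\omega)$: black boundary vertices $1,\dots,2n$ of degree $1$ ($2i-1$ at $\bar i$, $2i$ on the arc between $\bar i$ and $\overline{i+1}$); white interior vertices $b_v$ (interior vertices $v$ of $\Gamma$), $b_F$ (interior faces $F$), $b_i$ (boundary vertices $\bar i$); black interior vertices $w_e$ at midpoints of edges $e$. Edges: $b_v$–$w_e$ with weight $\omega(e)$ if $v\in e$; $w_e$–$b_F$ weight $1$ if $e$ borders $F$; $b_i$–$(2i-1)$ weight $1$; $b_i$–$w_e$ weight $1$ for $e$ incident to $\bar i$; $2i$ joined with weight $1$ to the face vertex of the face containing it. $PN(\Gamma,\omega',O_2)$: same graph with a perfect orientation $O_2$ (interior black vertices have exactly one outgoing edge, interior white vertices exactly one incoming edge) with boundary sources $\{1,2,3,5,\dots,2n-1\}$ (it exists); edges directed white$\to$black keep their weight, edges directed black$\to$white get reciprocal weight. Boundary measurements $M_{ij}=\sum_{p:i\to j}(-1)^{\mathrm{wind}(p)}\mathrm{wt}(p)$ in Postnikov's sense. $M_B$ is the $(n+1)\times 2n$ matrix with rows indexed by sources in increasing order, identity in the source columns, and other entries $(-1)^sM_{ij}$ with $s$ the number of sources strictly between $i$ and $j$.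
   Formalization: The edges joining b_i to w_e (e incident to the boundary vertex i) carry weight ω(e) instead of 1; with weight 1 the claim fails, e.g. for n=2 and a single edge of conductance c between the two boundary vertices. *)

(* Defs.v *)
From mathcomp Require Import all_boot all_order all_algebra.
From mathcomp Require Import mpoly.
From Stdlib Require Import ClassicalEpsilon.

Set Implicit Arguments.
Unset Strict Implicit.
Unset Printing Implicit Defensive.

Import Order.TTheory GRing.Theory Num.Theory.
Local Open Scope ring_scope.

(* A graph drawn in a closed disk with m vertices on the boundary circle is
   encoded by the rotation system of the graph together with the circle.  The
   i-th arc of the circle, inr i, runs clockwise from the i-th boundary vertex
   to the next one.  The dart (inl e, b) runs from endpt e b to endpt e (~~ b),
   the dart (inr i, false) runs along the i-th arc clockwise and (inr i, true)
   counterclockwise; rotation d is the dart that follows d counterclockwise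
   around its tail.  Loops and parallel edges are allowed. *)
Record diskmap (m : nat) := DiskMap {
  vert : finType;
  edge : finType;
  endpt : edge -> bool -> vert;
  bdv : 'I_m -> vert;
  rotation : (edge + 'I_m) * bool -> (edge + 'I_m) * bool
}.

Section DiskMaps.
Variables (m : nat) (G : diskmap m).

Definition dart : finType := ((edge G + 'I_m) * bool)%type.

Definition dtail (d : dart) : vert G :=
  match d with
  | (inl e, b) => endpt e b
  | (inr i, b) => bdv G (if b then ordS i else i)
  end.

Definition flip (d : dart) : dart := (d.1, ~~ d.2).

Definition dhead (d : dart) : vert G := dtail (flip d).

Definition rotd : dart -> dart := @rotation m G.

(* Successor of d along the boundary of the face lying to the left of d. *)
Definition face (d : dart) : dart := finv rotd (flip d).

(* rotd permutes cyclically the darts at each vertex; the graph together with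
   the circle is connected; the outside of the disk is a face bounded by the
   circle alone; the genus is zero. *)
Definition planar_disk : Prop :=
  [/\ injective (bdv G),
      injective rotd /\
        (forall d d' : dart, fconnect rotd d d' = (dtail d == dtail d')),
      forall u v : vert G,
        connect [rel x y | [exists d : dart, (dtail d == x) && (dhead d == y)]] u v,
      forall i : 'I_m, rotd (inr (ordS i), false) = (inr i, true)
    & (#|vert G| + fcard face dart = (#|edge G| + m) + 2)%N].

Definition interior (v : vert G) : bool := v \notin codom (bdv G).

Section Response.
Variables (R : realFieldType) (w : edge G -> R).

(* Current flowing from v into the network under the potential h. *)
Definition current (h : vert G -> R) (v : vert G) : R :=
  \sum_(d : edge G * bool | endpt d.1 d.2 == v)
     w d.1 * (h v - h (endpt d.1 (~~ d.2))).

Definition harmonic (h : vert G -> R) : Prop :=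
  forall v, interior v -> current h v = 0.

Definition response_matrix (x : 'M[R]_m) : Prop :=
  forall h, harmonic h ->
  forall i, current h (bdv G i) = \sum_j x i j * h (bdv G j).

End Response.

(* The darts connected to those of C by left_step C are the darts whose left
   face lies on the left side of C. *)
Definition left_step (C : seq dart) : rel dart :=
  [rel x y | (y == face x) || ((y == flip x) && (x.1 \notin [seq d.1 | d <- C]))].

(* A simple closed path is counterclockwise when the outside of the disk, which
   is to the left of the darts (inr i, false), is not to its left. *)
Definition counterclockwise (C : seq dart) : bool :=
  ~~ has (fun d => [exists i, connect (left_step C) d (inr i, false)]) C.

Definition turn (C : seq dart) : int := if counterclockwise C then 1 else -1.

(* Correction at a self-intersection entered by e1 and e3 and left by e2 and e4:
   1 if e1, e2, e3, e4 are in clockwise order, -1 if they are in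
   counterclockwise order, 0 otherwise. *)
Definition crossing (e1 e2 e3 e4 : dart) : int :=
  let pos d := index d (fingraph.orbit rotd (flip e1)) in
  if [&& 0 < pos e2, pos e2 < pos (flip e3) & pos (flip e3) < pos e4]%N then -1
  else if [&& 0 < pos e4, pos e4 < pos (flip e3) & pos (flip e3) < pos e2]%N
  then 1 else 0.

(* Postnikov's recursive computation of the winding index: if P' is obtained
   from P by erasing a closed segment C, then
   wind P = wind P' + wind C + crossing, and a path without self-intersections
   has index 0.  The segment erased is always the one closed first, which is a
   simple closed path.  The path is s ++ p, with s free of self-intersections. *)
Fixpoint wind_from (s p : seq dart) : int :=
  if p is d :: p' then
    let s' := rcons s d in
    let k := find (fun d' => dtail d' == dhead d) s' in
    if (k < size s')%N then
      let C := drop k s' in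
      let eps := match rev (take k s'), p' with
                 | e1 :: _, e4 :: _ => crossing e1 (head d C) d e4
                 | _, _ => 0
                 end in
      turn C + eps + wind_from (take k s') p'
    else wind_from s' p'
  else 0.

Definition wind (p : seq dart) : int := wind_from [::] p.

Section Oriented.
Variable O : edge G -> bool.

Definition odart (e : edge G) : dart := (inl e, O e).

Definition perfect (white : vert G -> bool) : Prop :=
  forall v, interior v ->
    if white v then #|[set e | dhead (odart e) == v]| = 1%N
    else #|[set e | dtail (odart e) == v]| = 1%N.

Definition sources : {set 'I_m} :=
  [set i | [exists e, dtail (odart e) == bdv G i]].

Fixpoint dwalk (u v : vert G) (p : seq (edge G)) : bool :=
  if p is e :: p' then (dtail (odart e) == u) && dwalk (dhead (odart e)) v p'
  else u == v.

Variables (R : realFieldType) (w : edge G -> R).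

(* Part of degree at most k of the formal power series
   \sum_p (-1)^(wind p) \prod_(e in p) X_e in the edge variables X_e. *)
Definition bm_trunc (i j : 'I_m) (k : nat) : {mpoly R[#|edge G|]} :=
  \sum_(l < k.+1)
    \sum_(p : l.-tuple (edge G) | dwalk (bdv G i) (bdv G j) p)
      ((-1) ^ wind [seq odart e | e <- p]) *:
        \prod_(e <- p) 'X_(enum_rank e).

(* That series is a rational expression f / g, and the boundary measurement is
   its value at the edge weights.  (The numerical series need not converge.)
   The value does not depend on the choice of f and g. *)
Definition bm_value (i j : 'I_m) (z : R) : Prop :=
  exists f g : {mpoly R[#|edge G|]},
    [/\ forall (k : nat) (a : 'X_{1..#|edge G|}), (mdeg a <= k)%N ->
          mcoeff a (g * bm_trunc i j k) = mcoeff a f,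
        meval (fun r => w (enum_val r)) g != 0
      & z = meval (fun r => w (enum_val r)) f / meval (fun r => w (enum_val r)) g].

Definition boundary_measurement (i j : 'I_m) : R :=
  epsilon (inhabits 0) (bm_value i j).

Definition ext_bm_matrix : 'M[R]_(#|sources|, m) :=
  \matrix_(r < #|sources|, c < m)
    let s := enum_val r in
    if c \in sources then (c == s)%:R
    else (-1) ^+ #|[set k in sources | (minn s c < k < maxn s c)%N]|
         * boundary_measurement s c.

End Oriented.
End DiskMaps.

(* Boundary labels start from 0: the label 2 i - 1 of the text is
   2 (i - 1) here, and 2 i is 2 (i - 1) + 1. *)

Lemma half_ord_subproof n (c : 'I_(n.*2)) : (c./2 < n)%N.
Proof. by rewrite ltn_half_double. Qed.

Definition half_ord n (c : 'I_(n.*2)) : 'I_n := Ordinal (half_ord_subproof c).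

Lemma double_ord_subproof n (i : 'I_n) (b : bool) : (b + i.*2 < n.*2)%N.
Proof. by case: b; rewrite ?add1n ?add0n ?ltn_Sdouble ?ltn_double. Qed.

Definition double_ord n (i : 'I_n) (b : bool) : 'I_(n.*2) :=
  Ordinal (double_ord_subproof i b).

Section Temperley.
Variables (n : nat) (G : diskmap n).

(* The darts of the graph and the arcs of the circle.  An arc i stands for the
   outward direction at the i-th boundary vertex (vdart), or for the arc as
   seen from the face inside the disk (fdart). *)
Definition hedge : finType := ((edge G * bool) + 'I_n)%type.

Definition vdart (x : hedge) : dart G :=
  match x with inl (e, b) => (inl e, b) | inr i => (inr i, false) end.

Definition fdart (x : hedge) : dart G :=
  match x with inl (e, b) => (inl e, b) | inr i => (inr i, true) end.

Definition face_set (x : hedge) : {set dart G} :=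
  [set d | fconnect (@face n G) (fdart x) d].

Definition disk_faces : {set {set dart G}} := [set face_set x | x in [set: hedge]].

Definition disk_face : finType := {F : {set dart G} | F \in disk_faces}.

Definition face_of (x : hedge) : disk_face :=
  exist _ (face_set x) (imset_f face_set (in_setT x)).

(* Black vertices: boundary vertices (inl (inl c)) and w_e (inl (inr e)).
   White vertices: b_v and b_i (inr (inl v)), b_F (inr (inr F)). *)
Definition nd_vert : finType :=
  (('I_(n.*2) + edge G) + (vert G + disk_face))%type.

(* (x, true) joins the white vertex b_v, v = dtail (vdart x), and (x, false)
   joins the white vertex b_F, F = face_of x, to w_e if x is a dart of the edge
   e, and to a boundary vertex if x is an arc.  In particular an edge with the
   same face on both sides gives two edges from w_e to b_F. *)
Definition nd_edge : finType := (hedge * bool)%type.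

Definition nd_white_end (y : nd_edge) : nd_vert :=
  let: (x, s) := y in
  inr (if s then inl (dtail (vdart x)) else inr (face_of x)).

Definition nd_black_end (y : nd_edge) : nd_vert :=
  match y with
  | (inl (e, _), _) => inl (inr e)
  | (inr i, s) => inl (inl (double_ord i (~~ s)))
  end.

Definition nd_endpt (y : nd_edge) (b : bool) : nd_vert :=
  if b then nd_white_end y else nd_black_end y.

Definition hedge_at_vertex (d : dart G) : option hedge :=
  match d with
  | (inl e, b) => Some (inl (e, b))
  | (inr i, false) => Some (inr i)
  | (inr _, true) => None
  end.

(* The two arcs at a boundary vertex are consecutive and are merged into the
   edge leading to the boundary of the disk. *)
Definition next_at_vertex (x : hedge) : hedge :=
  let d := rotd (vdart x) in
  odflt x (if hedge_at_vertex d is Some y then Some y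
           else hedge_at_vertex (rotd d)).

(* Going around b_F counterclockwise is following the boundary of F with F on
   the left; the default value is never used, as (inr _, false) borders the
   outside of the disk. *)
Definition next_at_face (x : hedge) : hedge :=
  match face (fdart x) with
  | (inl e, b) => inl (e, b)
  | (inr i, true) => inr i
  | (inr _, false) => x
  end.

Definition nd_rotation (d : (nd_edge + 'I_(n.*2)) * bool) :
    (nd_edge + 'I_(n.*2)) * bool :=
  match d with
  | (inl (x, s), true) =>
      (inl (if s then next_at_vertex x else next_at_face x, s), true)
  | (inl (x, s), false) =>
      match x with
      | inl (e, b) =>
          (inl (if s then (inl (e, ~~ b), false) else (inl (e, b), true)), false)
      | inr i => (inr (double_ord i (~~ s)), false)
      end
  | (inr c, false) => (inr (ord_pred c), true)
  | (inr c, true) =>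
      let c' := ordS c in (inl (inr (half_ord c'), ~~ odd c'), false)
  end.

Definition temperley : diskmap n.*2 :=
  @DiskMap n.*2 nd_vert nd_edge nd_endpt (fun c => inl (inl c)) nd_rotation.

Definition nd_white (v : vert temperley) : bool :=
  if v is inr _ then true else false.

Variables (R : realFieldType) (w : edge G -> R).

(* Both ends of e, interior or not, are joined to w_e with weight w e. *)
Definition nd_weight (y : edge temperley) : R :=
  if y is (inl (e, _), true) then w e else 1.

Definition pn_weight (O : edge temperley -> bool) (y : edge temperley) : R :=
  if nd_white (dtail (odart O y)) then nd_weight y else (nd_weight y)^-1.

Definition pn_matrix (O : edge temperley -> bool) :
    'M[R]_(#|sources O|, n.*2) :=
  ext_bm_matrix O (pn_weight O).

End Temperley.

(* {1, 2, 3, 5, ..., 2n-1} *)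
Definition O2_sources n : {set 'I_(n.*2)} :=
  [set c : 'I_(n.*2) | ~~ odd c || (val c == 1%N)].

Section Target.
Variables (R : realFieldType) (n : nat) (S : 'M[R]_n).

Definition M_mx : 'M[R]_(1 + n, n.*2) :=
  col_mx (\row_(c < n.*2) (odd c)%:R)
         (\matrix_(k < n, c < n.*2)
            if odd c then S k (half_ord c) else (half_ord c == k)%:R).

Definition D_mx : 'M[R]_(n.*2) := diag_mx (\row_(c < n.*2) (-1) ^+ c./2).

End Target.

(* Main.v *)
(** A perfect orientation is a matching of the white vertices, so that each
    crossing correction vanishes and [(-1) ^ wind] only counts the loops erased
    from a walk.  Give the half-edges of the Temperley graph the signs of the
    discrete Cauchy-Riemann equations [w (h v - h v') + (g F - g F') = 0].  The
    product of the signs is then [-1] along each simple cycle, and depends only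
    on the ends along each simple path between boundary vertices, so that the
    boundary measurements are, up to these signs, entries of the inverse of
    [1 - A] with [A] the signed weighted adjacency matrix.  A row of the inverse
    is a pair of conjugate harmonic functions [h], [g]; the current at the i-th
    boundary vertex is the variation of [g] across it, which is the recurrence
    that defines [S].

    For the sign of a cycle, the disk is completed to a sphere in such a way that
    each path becomes a cycle too.  Flipping a matching along a cycle multiplies
    its sign in the Kasteleyn determinant by minus the sign of the cycle, and all
    matchings have the same sign: each of them is deformed to the matrix of the
    whole Cauchy-Riemann system through nonsingular matrices. *)

(* Planarity is used as linear algebra, without the Jordan curve theorem: coboundaries of vertex
   functions are orthogonal to coboundaries of face functions, and connectivity holds globally and
   around each vertex and face ([half_planar]). A matching pairs the edges with all vertices and
   faces but one of each, which is the Euler relation; it makes the systems of discrete Hodge theory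
   square, so that injectivity gives solvability. Decoupling vertices from faces leaves a
   nonsingular system only if the matched edges of the vertices contain no cycle, as in Temperley's
   bijection with spanning trees. The deformations rest on the intermediate value theorem, so they
   are run over the real closed field [realalg]; the resulting identities between signs are integral
   and pass to [R]. The sphere depends on the end of the path because all sinks are sent to one
   extra edge, which borders a single face of the disk. *)
Require Import Defs.
From mathcomp Require Import all_boot all_order all_algebra.
From mathcomp Require Import perm mpoly ring zify realalg.
From Stdlib Require Import ClassicalEpsilon.

Set Implicit Arguments.
Unset Strict Implicit.
Unset Printing Implicit Defensive.

Import Order.TTheory GRing.Theory Num.Theory.
Local Open Scope ring_scope.

(** * Matrices indexed by a finite type *)

Section FinMatrix.
Variables (R : fieldType) (W : finType).
Implicit Types (K : W -> W -> R) (u : W -> R).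

Definition fmx K : 'M[R]_#|W| := \matrix_(i, j) K (enum_val i) (enum_val j).

Lemma sum_enum_val (f : W -> R) : \sum_(i < #|W|) f (enum_val i) = \sum_x f x.
Proof. by rewrite -big_enum_val; apply: eq_bigl => x; rewrite inE. Qed.

Lemma sum_delta (x : W) u : \sum_y (x == y)%:R * u y = u x.
Proof.
rewrite (bigD1 x) //= eqxx mul1r big1 ?addr0 // => y /negPf ne.
by rewrite eq_sym ne mul0r.
Qed.

Lemma fmx_col K (c : 'cV[R]_#|W|) (x : W) :
  (fmx K *m c) (enum_rank x) ord0 = \sum_y K x y * c (enum_rank y) ord0.
Proof.
rewrite mxE -sum_enum_val; apply: eq_bigr => i _.
by rewrite mxE enum_rankK enum_valK.
Qed.

Lemma fmx_row K (c : 'rV[R]_#|W|) (y : W) :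
  (c *m fmx K) ord0 (enum_rank y) = \sum_x c ord0 (enum_rank x) * K x y.
Proof.
rewrite mxE -sum_enum_val; apply: eq_bigr => i _.
by rewrite mxE enum_rankK enum_valK.
Qed.

Lemma fmx_det_neq0 K :
  (forall u, (forall x, \sum_y K x y * u y = 0) -> forall x, u x = 0) ->
  \det (fmx K) != 0.
Proof.
move=> inj; rewrite -det_tr; apply/det0P=> -[v v_neq0 vK].
case/negP: v_neq0; apply/eqP/rowP=> i; rewrite mxE -[i]enum_valK.
apply: (inj (fun x => v ord0 (enum_rank x))) => x.
have: (v *m (fmx K)^T) ord0 (enum_rank x) = 0 by rewrite vK mxE.
rewrite mxE => vK0; rewrite -[RHS]vK0 -sum_enum_val; apply: eq_bigr => k _.
by rewrite !mxE enum_valK enum_rankK mulrC.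
Qed.

Lemma fmx_solve K (b : W -> R) :
  (forall u, (forall x, \sum_y K x y * u y = 0) -> forall x, u x = 0) ->
  exists u, forall x, \sum_y K x y * u y = b x.
Proof.
move=> /fmx_det_neq0 nz.
have Ku : fmx K \in unitmx by rewrite unitmxE unitfE.
exists (fun y => (invmx (fmx K) *m \col_i b (enum_val i)) (enum_rank y) ord0).
by move=> x; rewrite -fmx_col mulKVmx // mxE enum_rankK.
Qed.

Lemma fmx_left_kernel K u x0 :
  u x0 != 0 -> (forall x, \sum_y K x y * u y = 0) ->
  exists2 f : W -> R, exists x, f x != 0 & forall y, \sum_x f x * K x y = 0.
Proof.
move=> ux0 Ku0.
have: \det (fmx K) == 0.
  rewrite -det_tr; apply/det0P; exists (\row_i u (enum_val i)).
    apply: contraNneq ux0 => /rowP/(_ (enum_rank x0)).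
    by rewrite !mxE enum_rankK => ->.
  apply/rowP=> i; rewrite !mxE -[RHS](Ku0 (enum_val i)) -sum_enum_val.
  by apply: eq_bigr => k _; rewrite !mxE mulrC.
case/det0P=> v v_neq0 vK; exists (fun x => v ord0 (enum_rank x)).
  case/rV0Pn: v_neq0 => i vi; exists (enum_val i).
  by rewrite enum_valK.
by move=> y; rewrite -fmx_row vK mxE.
Qed.

Lemma fmx_id : \det (fmx (fun x y => (x == y)%:R)) = 1.
Proof.
rewrite -[RHS](@det1 R #|W|); congr (\det _); apply/matrixP=> i j.
by rewrite !mxE (inj_eq enum_val_inj).
Qed.

Lemma det_fmx_scale (a : W -> R) K :
  \det (fmx (fun x y => a x * K x y)) = (\prod_x a x) * \det (fmx K).
Proof.
rewrite (_ : fmx _ = diag_mx (\row_i a (enum_val i)) *m fmx K).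
  rewrite det_mulmx det_diag; congr (_ * _).
  under eq_bigr => i _ do rewrite mxE.
  by rewrite -(big_enum_val a); apply: eq_bigl => x; rewrite inE.
by apply/matrixP=> i j; rewrite mul_diag_mx !mxE.
Qed.

Lemma det_fmx_tperm K (a b : W) : a != b ->
  \det (fmx (fun x => K (tperm a b x))) = - \det (fmx K).
Proof.
move=> neq_ab.
have neq: enum_rank a != enum_rank b by rewrite (inj_eq enum_rank_inj).
have -> : fmx (fun x => K (tperm a b x)) =
          xrow (enum_rank a) (enum_rank b) (fmx K).
  apply/matrixP=> i j; rewrite !mxE; congr (K _ _).
  case: tpermP => [<-|<-|/eqP ni /eqP nj]; rewrite ?enum_valK ?tpermL ?tpermR.
  - by rewrite enum_rankK.
  - by rewrite enum_rankK.
  rewrite tpermD //; apply/eqP=> E; move: ni nj; rewrite -E enum_rankK eqxx //.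
by rewrite xrowE det_mulmx det_perm odd_tperm neq expr1 mulN1r.
Qed.

(** A cycle of length k is a product of k - 1 transpositions: [next (a :: b :: s)] is
    [next (a :: s)] after the exchange of [a] and [b]. *)
Lemma det_fmx_next K (s : seq W) : s != [::] -> uniq s ->
  \det (fmx (fun x => K (next s x))) = (-1) ^+ (size s).-1 * \det (fmx K).
Proof.
case: s => // a s _; elim: s => [|b s IHs] Us.
  rewrite mul1r; congr (\det _); apply/matrixP=> i j; rewrite !mxE.
  by congr (K _ _); rewrite /= eq_sym; case: eqP.
have neq_ab: a != b by case/andP: Us; rewrite inE; case: eqP.
have Us': uniq (a :: s).
  by move: Us; rewrite /= inE; case/and3P=> /norP[_ ->] _ ->.
rewrite [(size _).-1]/= exprS mulN1r mulNr -IHs // -(det_fmx_tperm _ neq_ab).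
congr (\det _); apply/matrixP=> i j; rewrite !mxE; congr (K _ _).
set x := enum_val i; case/and3P: Us; rewrite inE => /norP[_ a_s] b_s _.
have nextb: next (a :: s) b = b.
  by rewrite next_nth inE (eq_sym b) (negPf neq_ab) (negPf b_s).
case: tpermP => [->|->|/eqP xa /eqP xb].
- by rewrite nextb /= eqxx.
- rewrite /= eq_sym (negPf neq_ab).
  by case: (s) => [|c s'] /=; rewrite !eqxx.
by rewrite /= (negPf xa); case: (s) => [|c s'] /=; rewrite (negPf xa) (negPf xb).
Qed.

End FinMatrix.

Section Segment.
Variable R : rcfType.

(** The determinant along the segment is a polynomial in t, so a change of sign would produce a root
    in [0, 1]. *)
Lemma det_segment_gt0 n (A B : 'M[R]_n) :
  (forall t : R, 0 <= t <= 1 -> \det (A + t *: (B - A)) != 0) ->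
  0 < \det A -> 0 < \det B.
Proof.
move=> nz A_gt0.
pose P : 'M[{poly R}]_n := map_mx polyC A + 'X *: map_mx polyC (B - A).
have Pt t : (\det P).[t] = \det (A + t *: (B - A)).
  rewrite -horner_evalE -det_map_mx; congr (\det _); apply/matrixP=> i j.
  by rewrite !mxE /= /horner_eval !hornerE.
rewrite ltNge; apply/negP=> B_le0.
have [||t t01 /rootP] := @poly_ivt R (- \det P) 0 1; first exact: ler01.
  rewrite !hornerN !Pt scale0r addr0 scale1r [A + _]addrC subrK.
  by rewrite oppr_le0 oppr_ge0 ltW.
by rewrite hornerN Pt => /eqP; rewrite oppr_eq0 (negPf (nz t _)).
Qed.

End Segment.

(** * Matchings of a map on the sphere *)

Definition bsign {R : pzRingType} (b : bool) : R := if b then 1 else -1.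

Lemma bsignK (R : pzRingType) b : bsign b * bsign b = 1 :> R.
Proof. by case: b; rewrite /bsign ?mulr1 // mulrNN mulr1. Qed.

Section Coboundary.
Variables (R : fieldType) (V E : finType) (ends : E -> bool -> V).

Definition cobd (h : V -> R) (e : E) : R := h (ends e true) - h (ends e false).

Lemma cobd_half h e b :
  bsign b * cobd h e = h (ends e b) - h (ends e (~~ b)).
Proof. by case: b; rewrite /cobd ?mul1r ?mulN1r ?opprB. Qed.

Lemma sum_cobd_delta (W : finType) (i : V -> W) (u : W -> R) e :
  \sum_y cobd (fun v => (i v == y)%:R) e * u y = cobd (u \o i) e.
Proof.
rewrite /cobd; under eq_bigr => y _ do rewrite mulrBl.
by rewrite sumrB !sum_delta.
Qed.

End Coboundary.

Section PlanarIncidence.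
Variable R : realFieldType.

(* V, F and E play the roles of the vertices, the faces and the edges of a map
   on the sphere; the root vertex v0 is on the boundary of the root face r0. *)
Definition half_planar (V F E : finType) (vend : E -> bool -> V)
    (fend : E -> bool -> F) (v0 : V) (r0 : F) : Prop :=
  [/\ forall (h : V -> R) (g : F -> R), \sum_e cobd vend h e * cobd fend g e = 0,
      forall h : V -> R, (forall e, cobd vend h e = 0) -> forall v, h v = h v0,
      forall v (g : F -> R), (forall e b, vend e b = v -> cobd fend g e = 0) ->
        forall e b e' b', vend e b = v -> vend e' b' = v ->
        g (fend e true) = g (fend e' true)
    & forall g : F -> R, (forall e b, vend e b = v0 -> cobd fend g e = 0) ->
        forall e b, vend e b = v0 -> g (fend e true) = g r0].

Record matching (V F E : finType) (vend : E -> bool -> V)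
    (fend : E -> bool -> F) (v0 : V) (r0 : F)
    (mv : V -> E * bool) (mf : F -> E * bool) : Prop := Matching {
  mv_end : forall v, v != v0 -> vend (mv v).1 (mv v).2 = v;
  mf_end : forall f, f != r0 -> fend (mf f).1 (mf f).2 = f;
  mv_inj : forall v v', v != v0 -> v' != v0 -> (mv v).1 = (mv v').1 -> v = v';
  mf_inj : forall f f', f != r0 -> f' != r0 -> (mf f).1 = (mf f').1 -> f = f';
  mvf_neq : forall v f, v != v0 -> f != r0 -> (mv v).1 <> (mf f).1;
  m_surj : forall e, (exists2 v, v != v0 & (mv v).1 = e) \/
                     (exists2 f, f != r0 & (mf f).1 = e)
}.

Section Exactness.
Variables (V F E : finType) (vend : E -> bool -> V) (fend : E -> bool -> F).
Variables (v0 : V) (r0 : F) (mv : V -> E * bool) (mf : F -> E * bool).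
Local Notation D := (@cobd R V E vend).
Local Notation D' := (@cobd R F E fend).
Hypothesis (plV : half_planar vend fend v0 r0) (plF : half_planar fend vend r0 v0).
Hypothesis (mm : matching vend fend v0 r0 mv mf).

Lemma sum_sqr_eq0 (I : finType) (f : I -> R) :
  \sum_i f i * f i = 0 -> forall i, f i = 0.
Proof.
move=> s0 i; apply/eqP; rewrite -sqrf_eq0 expr2; apply/eqP.
have pos j : true -> 0 <= f j * f j by rewrite -expr2 sqr_ge0.
exact: (psumr_eq0P pos s0).
Qed.

(** This is the vanishing of the first cohomology of the sphere. The matching selects each edge
    once, so the equations z = D h + D' g, with h and g zero at the roots, form a square system; it
    is injective because D h and D' g are orthogonal. If z is orthogonal to all D h, the part D h of
    z is orthogonal to itself. *)
Lemma exactness (z : E -> R) :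
  (forall h, \sum_e z e * D h e = 0) ->
  exists2 g : F -> R, g r0 = 0 & forall e, z e = D' g e.
Proof.
case: plV => orth cV _ _; case: plF => _ cF _ _ z_orth.
pose row e (u : V + F -> R) := D (u \o inl) e + D' (u \o inr) e.
pose K (x y : V + F) : R :=
  match x with
  | inl v => if v == v0 then (x == y)%:R else row (mv v).1 (fun t => (t == y)%:R)
  | inr f => if f == r0 then (x == y)%:R else row (mf f).1 (fun t => (t == y)%:R)
  end.
have rowE e u : \sum_y row e (fun t => (t == y)%:R) * u y = row e u.
  rewrite /row; under eq_bigr => y _ do rewrite mulrDl.
  by rewrite big_split; congr (_ + _); apply: sum_cobd_delta.
have KV v u : v != v0 -> \sum_y K (inl v) y * u y = row (mv v).1 u.
  by move=> /negPf nv; rewrite /K nv rowE.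
have KF f u : f != r0 -> \sum_y K (inr f) y * u y = row (mf f).1 u.
  by move=> /negPf nf; rewrite /K nf rowE.
have KV0 u : \sum_y K (inl v0) y * u y = u (inl v0).
  by rewrite /K eqxx sum_delta.
have KF0 u : \sum_y K (inr r0) y * u y = u (inr r0).
  by rewrite /K eqxx sum_delta.
have inj u : (forall x, \sum_y K x y * u y = 0) -> forall x, u x = 0.
  move=> Ku0.
  have r_eq0 e : row e u = 0.
    by case: (m_surj mm e) => -[t nt <-]; rewrite -?KV -?KF.
  have uD e : D (u \o inl) e = 0.
    apply: sum_sqr_eq0 => {e}; rewrite -[RHS](orth (u \o inl) (fun f => - u (inr f))).
    apply: eq_bigr => e _; congr (_ * _); move/eqP: (r_eq0 e).
    by rewrite addr_eq0 => /eqP ->; rewrite /cobd /= opprB opprK addrC.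
  have uD' e : D' (u \o inr) e = 0 by move: (r_eq0 e); rewrite /row uD add0r.
  case=> [v|f].
    by have /= -> := cV _ uD v; rewrite -KV0.
  by have /= -> := cF _ uD' f; rewrite -KF0.
pose b (x : V + F) : R :=
  match x with
  | inl v => if v == v0 then 0 else z (mv v).1
  | inr f => if f == r0 then 0 else z (mf f).1
  end.
have [u uE] := fmx_solve b inj.
have zE e : z e = row e u.
  case: (m_surj mm e) => -[t nt <-]; rewrite -?KV -?KF // uE /b (negPf nt) //.
have uD e : D (u \o inl) e = 0.
  apply: sum_sqr_eq0 => {e}.
  transitivity (\sum_e z e * D (u \o inl) e
                - \sum_e D (u \o inl) e * D' (u \o inr) e).
    2: by rewrite z_orth orth subrr.
  rewrite -sumrB; apply: eq_bigr => e _; rewrite zE /row; ring.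
exists (u \o inr); first by rewrite /= -KF0 uE /b eqxx.
by move=> e; rewrite zE /row uD add0r.
Qed.

End Exactness.

Section Acyclicity.
Variables (V F E : finType) (vend : E -> bool -> V) (fend : E -> bool -> F).
Variables (v0 : V) (r0 : F) (mv : V -> E * bool) (mf : F -> E * bool).
Local Notation D := (@cobd R V E vend).
Local Notation D' := (@cobd R F E fend).
Hypothesis (plV : half_planar vend fend v0 r0) (plF : half_planar fend vend r0 v0).
Hypothesis (mm : matching vend fend v0 r0 mv mf).

Definition along (v : V) : V := vend (mv v).1 (~~ (mv v).2).

(* If the matched edges of Z formed a cycle z, then z = D' g would enclose the
   region A where g is not zero.  The matching would embed the vertices in the
   closure of A and the faces of A into its edges, whereas the relation that the
   divergences sum to zero yields a nonzero vector phi on these edges without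
   divergence and without circulation around the faces of A.  As phi = D' g',
   cutting g' off outside A changes phi by a multiple of z, whence
   <phi, phi> = 0. *)
Lemma matching_acyclic_min (Z : {set V}) :
  v0 \notin Z -> Z != set0 -> {in Z, forall v, along v \in Z} ->
  (forall Y : {set V}, Y \subset Z -> Y != set0 ->
     {in Y, forall v, along v \in Y} -> Y = Z) -> False.
Proof.
move=> v0Z Z_neq0 Zst Zmin.
have [orth _ link rootP] := plV.
have nz v : v \in Z -> v != v0 by move=> vZ; apply: contraNneq v0Z => <-.
(* By minimality [along] permutes [Z], which is why the chain [z] below has zero divergence. *)
have imZ : [set along v | v in Z] = Z.
  apply: Zmin.
  - by apply/subsetP=> _ /imsetP[v vZ ->]; apply: Zst.
  - case/set0Pn: Z_neq0 => v vZ; apply/set0Pn; exists (along v).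
    exact: imset_f.
  by move=> _ /imsetP[v vZ ->]; apply: imset_f; apply: Zst.
have injZ : {in Z &, injective along} by apply/imset_injP; rewrite imZ.
pose TZ := [set (mv v).1 | v in Z].
pose yc (c : V -> R) e : R :=
  \sum_(v in Z) ((mv v).1 == e)%:R * bsign (mv v).2 * c v.
have ycD c h : \sum_e yc c e * D h e = \sum_(v in Z) c v * (h v - h (along v)).
  rewrite /yc; under eq_bigr => e _ do rewrite mulr_suml.
  rewrite exchange_big; apply: eq_bigr => v vZ /=.
  rewrite (bigD1 (mv v).1) //= eqxx big1 ?addr0; last first.
    by move=> e ne; rewrite eq_sym (negPf ne) !mul0r.
  rewrite mul1r mulrAC cobd_half (mv_end mm) ?nz // mulrC //.
have ycZ c v : v \in Z -> yc c (mv v).1 = bsign (mv v).2 * c v.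
  move=> vZ; rewrite /yc (bigD1 v) //= eqxx mul1r big1 ?addr0 // => v' /andP[v'Z ne].
  case: eqP => [|_]; last by rewrite !mul0r.
  by move/(mv_inj mm (nz _ v'Z) (nz _ vZ)) => e; rewrite e eqxx in ne.
have ycN c e : e \notin TZ -> yc c e = 0.
  move=> eT; rewrite /yc big1 // => v vZ; case: eqP => [ee|_]; last by rewrite !mul0r.
  by case/negP: eT; rewrite -ee; apply: imset_f.
pose z := yc (fun=> 1).
have z_orth h : \sum_e z e * D h e = 0.
  rewrite ycD; under eq_bigr => v _ do rewrite mul1r.
  rewrite sumrB -[X in _ - X](big_imset h injZ) /= imZ subrr //.
have [g gr0 zE] := exactness plV plF mm z_orth.
have gT e : e \notin TZ -> g (fend e true) = g (fend e false).
  by move=> /ycN-/(_ (fun=> 1)) z0; apply/eqP; rewrite -subr_eq0; apply/eqP; rewrite -[LHS]zE.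
have TZend e b : e \in TZ -> vend e b \in Z.
  case/imsetP=> v vZ ->; case: (eqVneq b (mv v).2) => [->|].
    by rewrite (mv_end mm) ?nz.
  by move: (Zst v vZ); rewrite /along; case: b; case: (mv v).2.
(* [EA] selects the edges off the cycle with the region on both sides, since [g] is constant across
   an edge off the cycle; [VA] selects the vertices strictly inside the region. *)
pose EA e := (e \notin TZ) && (g (fend e true) != 0).
pose VA v := (v \notin Z) && [exists e, [exists b, (vend e b == v) && EA e]].
have VAedge v e b : VA v -> vend e b = v -> EA e.
  case/andP=> vZ /existsP[e' /existsP[b' /andP[/eqP e'v /andP[e'T ge']]]] ev.
  have noT e1 b1 : vend e1 b1 = v -> e1 \notin TZ.
    by move=> e1v; apply: contra vZ; rewrite -e1v; apply: TZend.
  rewrite /EA (noT _ _ ev) /= (link v g _ e b e' b') // => e1 b1 /noT/gT e1E.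
  by rewrite /cobd e1E subrr.
(* Around a root vertex inside the region [g] would be constant, hence equal to its value 0 on the
   root face. *)
have VA0 : ~~ VA v0.
  apply/negP=> /[dup] VAv0 /andP[_ /existsP[e /existsP[b /andP[/eqP ev /andP[_ /eqP]]]]].
  apply; rewrite -gr0; apply: rootP ev => e' b' /VAedge-/(_ VAv0)/andP[/gT e'E _].
  by rewrite /cobd e'E subrr.
pose V' v := (v \in Z) || VA v.
have V'0 v : V' v -> v != v0.
  by case/orP=> [/nz//|]; apply: contraTneq => ->.
have E'end e b : (e \in TZ) || EA e -> V' (vend e b).
  rewrite /V'; case/orP=> [/TZend ->//|Ee].
  case: (boolP (_ \in Z)) => //= nZ; rewrite /VA nZ /=.
  by apply/existsP; exists e; apply/existsP; exists b; rewrite eqxx.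
pose U (x : V + F) := match x with inl v => V' v | inr f => g f != 0 end.
pose ed (x : V + F) := match x with inl v => (mv v).1 | inr f => (mf f).1 end.
have gn f : g f != 0 -> f != r0 by apply: contraNneq => ->; rewrite gr0.
have edU x : U x -> (ed x \in TZ) || EA (ed x).
  case: x => [v|f] /=.
    case/orP=> [vZ|VAv]; first by apply/orP; left; apply: imset_f.
    rewrite (@VAedge v _ (mv v).2) ?orbT ?(mv_end mm) ?V'0 //.
    by rewrite /V' VAv orbT.
  move=> gf; have fT : (mf f).1 \notin TZ.
    by apply/imsetP=> -[v vZ] /esym/(mvf_neq mm); apply; rewrite ?nz ?gn.
  rewrite /EA (negPf fT) /=; have := mf_end mm (gn _ gf).
  by case: (mf f).2 => fE; [|rewrite gT //]; rewrite fE.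
have ed_inj x y : U x -> U y -> ed x = ed y -> x = y.
  case: x y => [v|f] [v'|f'] /= Ux Uy.
  - by move/(mv_inj mm)=> ->; rewrite ?V'0.
  - by move/(mvf_neq mm)=> []; rewrite ?V'0 ?gn.
  - by move/esym/(mvf_neq mm)=> []; rewrite ?V'0 ?gn.
  by move/(mf_inj mm)=> ->; rewrite ?gn.
pose col (y : V + F) e : R :=
  D (fun v => (inl v == y)%:R) e + D' (fun f => (inr f == y)%:R) e.
have colE u e : \sum_y col y e * u y = D (u \o inl) e + D' (u \o inr) e.
  rewrite /col; under eq_bigr => y _ do rewrite mulrDl.
  by rewrite big_split /= !sum_cobd_delta.
pose K (x y : V + F) : R := if U x && U y then col y (ed x) else (x == y)%:R.
(* The indicator of the vertices of the closed region is in the right kernel of [K], as each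
   selected edge has both ends there. [K] being square, a left kernel vector [f] follows. *)
pose u (y : V + F) : R := match y with inl v => (V' v)%:R | inr _ => 0 end.
have [v1 v1Z] := set0Pn _ Z_neq0.
have uN y : ~~ U y -> u y = 0 by case: y => //= v /negPf ->.
have [||f [x1 fx1] fK] := @fmx_left_kernel _ _ K u (inl v1).
- by rewrite /= /V' v1Z oner_neq0.
- move=> x; case: (boolP (U x)) => [Ux|nUx]; last first.
    by rewrite /K (negPf nUx) /= sum_delta uN.
  have -> : \sum_y K x y * u y = \sum_y col y (ed x) * u y.
    apply: eq_bigr => y _; rewrite /K Ux /=; case: ifP => // /negbT nUy.
    by rewrite uN // !mulr0.
  by rewrite colE /cobd /= !E'end ?edU // !subrr addr0.
have fN x : ~~ U x -> f x = 0.
  move=> nUx; rewrite -[RHS](fK x) (bigD1 x) //= /K (negPf nUx) andbF eqxx mulr1.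
  by rewrite big1 ?addr0 // => y /negPf ne; rewrite andbF ne mulr0.
pose phi e : R := \sum_x f x * (ed x == e)%:R.
have phiE (q : E -> R) : \sum_e phi e * q e = \sum_x f x * q (ed x).
  rewrite /phi; under eq_bigr => e _ do rewrite mulr_suml.
  rewrite exchange_big; apply: eq_bigr => x _ /=.
  rewrite (bigD1 (ed x)) //= eqxx big1 ?addr0 ?mulr1 // => e ne.
  by rewrite eq_sym (negPf ne) mulr0 mul0r.
have phi_col y : U y -> \sum_e phi e * col y e = 0.
  move=> Uy; rewrite phiE -[RHS](fK y); apply: eq_bigr => x _.
  case: (boolP (U x)) => [Ux|/fN ->]; last by rewrite !mul0r.
  by rewrite /K Ux Uy.
have phi_u (t : V + F -> R) : (forall y, ~~ U y -> t y = 0) ->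
    \sum_e phi e * (D (t \o inl) e + D' (t \o inr) e) = 0.
  move=> t0; under eq_bigr => e _ do rewrite -colE mulr_sumr.
  rewrite exchange_big big1 // => y _ /=.
  case: (boolP (U y)) => [Uy|/t0 ty]; last by rewrite big1 // => e _; rewrite ty !mulr0.
  under eq_bigr => e _ do rewrite mulrA.
  by rewrite -mulr_suml phi_col // mul0r.
have phi_orth h : \sum_e phi e * D h e = 0.
  rewrite phiE.
  pose t (y : V + F) := match y with inl v => (V' v)%:R * h v | inr _ => 0 end.
  rewrite -[RHS](@phi_u t); last by case=> //= v /negPf ->; rewrite mul0r.
  rewrite phiE; apply: eq_bigr => x _.
  case: (boolP (U x)) => [Ux|/fN ->]; last by rewrite !mul0r.
  by rewrite /cobd /= !E'end ?edU // !mul1r subrr addr0.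
have [g' g'r0 phiD'] := exactness plV plF mm phi_orth.
pose gA f := if g f != 0 then g' f else 0.
have phi_face (ga : F -> R) : (forall f, g f = 0 -> ga f = 0) ->
    \sum_e phi e * D' ga e = 0.
  move=> ga0.
  rewrite -[RHS](@phi_u (fun y => match y with inl _ => 0 | inr f => ga f end)).
    by apply: eq_bigr => e _; rewrite {2}/cobd /= subrr add0r.
  by case=> //= f'; rewrite negbK => /eqP/ga0.
(* The cut-off error [y] lives on the cycle and has no divergence, so it must be a multiple of
   [z]. *)
pose y e := phi e - D' gA e.
have yN e : e \notin TZ -> y e = 0.
  move=> eT; rewrite /y phiD' /cobd /gA -(gT e eT); case: ifP => [_|/negbT/negbNE gt0].
    by rewrite subrr.
  rewrite !subr0 -[LHS](phiD' e) /phi big1 // => x _.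
  case: (boolP (U x)) => [Ux|/fN ->]; last by rewrite mul0r.
  case: eqP => [xe|_]; last by rewrite mulr0.
  by move: (edU x Ux); rewrite xe /EA (negPf eT) gt0.
pose c v := bsign (mv v).2 * y (mv v).1.
have yE e : y e = yc c e.
  case: (boolP (e \in TZ)) => [/imsetP[v vZ ->]|eT]; last by rewrite yN // ycN.
  by rewrite ycZ // /c mulrA bsignK mul1r.
have y_orth h : \sum_e y e * D h e = 0.
  rewrite /y; under eq_bigr => e _ do rewrite mulrBl.
  rewrite sumrB phi_orth; under eq_bigr => e _ do rewrite mulrC.
  by rewrite orth subrr.
have c_along v : v \in Z -> c (along v) = c v.
  move=> vZ; apply/eqP; rewrite -subr_eq0; apply/eqP.
  rewrite -[RHS](y_orth (fun t => (t == along v)%:R)).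
  under [RHS]eq_bigr => e _ do rewrite yE.
  rewrite ycD; under eq_bigr => v' _ do rewrite mulrBr.
  rewrite sumrB; congr (_ - _).
    rewrite (bigD1 (along v)) ?Zst //= eqxx mulr1 big1 ?addr0 // => v' /andP[_ /negPf ->].
    by rewrite mulr0.
  rewrite (bigD1 v) //= eqxx mulr1 big1 ?addr0 // => v' /andP[v'Z ne].
  case: eqP => [/injZ-/(_ v'Z vZ) e|_]; last by rewrite mulr0.
  by rewrite e eqxx in ne.
(* A level set of [c] in [Z] is stable under [along], so minimality makes it all of [Z]. *)
have cE v : v \in Z -> c v = c v1.
  have -> : Z = [set v in Z | c v == c v1].
    apply/esym/Zmin.
    - by apply/subsetP=> t; rewrite inE => /andP[].
    - by apply/set0Pn; exists v1; rewrite inE v1Z eqxx.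
    by move=> t; rewrite !inE => /andP[tZ /eqP ct]; rewrite Zst // c_along // ct eqxx.
  by rewrite inE => /andP[_ /eqP].
have yz e : y e = c v1 * z e.
  rewrite yE /z /yc mulr_sumr; apply: eq_bigr => v vZ; rewrite cE // mulr1.
  by rewrite mulrC.
have phi0 e : phi e = 0.
  apply: sum_sqr_eq0 => {e}.
  transitivity (\sum_e phi e * D' gA e + c v1 * \sum_e phi e * D' g e).
    rewrite mulr_sumr -big_split; apply: eq_bigr => e _ /=.
    rewrite -zE mulrCA -mulrDr -yz; congr (_ * _); rewrite /y; ring.
  by rewrite !phi_face ?mulr0 ?addr0 // => t gt; rewrite /gA gt eqxx.
case: (boolP (U x1)) => [Ux1|/fN e]; last by rewrite e eqxx in fx1.
case/eqP: fx1; rewrite -[RHS](phi0 (ed x1)) /phi (bigD1 x1) //= eqxx mulr1.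
rewrite big1 ?addr0 // => x ne; case: (boolP (U x)) => [Ux|/fN ->]; last by rewrite mul0r.
by case: eqP => [/(ed_inj _ _ Ux Ux1) e|]; [rewrite e eqxx in ne|rewrite mulr0].
Qed.

Lemma matching_acyclic (Z : {set V}) :
  v0 \notin Z -> {in Z, forall v, along v \in Z} -> Z = set0.
Proof.
move=> v0Z Zst; apply/eqP; apply/negP=> /negP Z_neq0.
pose P (Y : {set V}) := (Y != set0) && [forall v in Y, along v \in Y].
have PZ : P Z by rewrite /P Z_neq0; apply/forall_inP.
have [Y /minsetP[/andP[Y0 /forall_inP Yst] Ymin] YZ] := minset_exists PZ.
apply: (@matching_acyclic_min Y) => //; first by apply: contra v0Z; apply/subsetP.
move=> X XY X0 Xst; apply: Ymin => //.
by rewrite /P X0; apply/forall_inP.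
Qed.

End Acyclicity.

End PlanarIncidence.

(** * Signs of matchings and cycles *)

Lemma matching_dual (V F E : finType) (vend : E -> bool -> V)
    (fend : E -> bool -> F) v0 r0 mv mf :
  matching vend fend v0 r0 mv mf -> matching fend vend r0 v0 mf mv.
Proof.
case=> a b c d e s; split=> // [f v f0 v0' /esym|x]; first exact: e.
by case: (s x); [right|left].
Qed.

Section Kasteleyn.
Variables (R : rcfType) (V F E : finType).
Variables (vend : E -> bool -> V) (fend : E -> bool -> F) (v0 : V) (r0 : F).
Local Notation D := (@cobd R V E vend).
Local Notation D' := (@cobd R F E fend).
Local Notation W := (V + F)%type.
Hypothesis (plV : half_planar R vend fend v0 r0).
Hypothesis (plF : half_planar R fend vend r0 v0).

Definition is_root (x : W) : bool :=
  match x with inl v => v == v0 | inr f => f == r0 end.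

Definition incident (x : W) (q : E * bool) : bool :=
  match x with inl v => vend q.1 q.2 == v | inr f => fend q.1 q.2 == f end.

Definition full_matching (m : W -> E * bool) : Prop :=
  [/\ forall x, ~~ is_root x -> incident x (m x),
      forall x y, ~~ is_root x -> ~~ is_root y -> (m x).1 = (m y).1 -> x = y
    & forall e, exists2 x, ~~ is_root x & (m x).1 = e].

Lemma full_matchingP (m : W -> E * bool) : full_matching m ->
  matching vend fend v0 r0 (m \o inl) (m \o inr).
Proof.
case=> inc inj surj; split=> /=.
- by move=> v nv; apply/eqP/(inc (inl v)).
- by move=> v nv; apply/eqP/(inc (inr v)).
- by move=> v v' nv nv' /(inj (inl v) (inl v') nv nv') [].
- by move=> v v' nv nv' /(inj (inr v) (inr v') nv nv') [].
- by move=> v f nv nf /(inj (inl v) (inr f) nv nf).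
move=> e; case: (surj e) => -[v|f] nx xe; [left|right].
  by exists v.
by exists f.
Qed.

Definition kform e (u : W -> R) : R := D (u \o inl) e + D' (u \o inr) e.

(** Row x is the Cauchy-Riemann form of the edge matched with x, signed so that the half-edge [m x]
    counts positively. The rows of the roots fix the additive constants of h and g. *)
Definition kast (m : W -> E * bool) (x y : W) : R :=
  if is_root x then (x == y)%:R
  else bsign (m x).2 * kform (m x).1 (fun t => (t == y)%:R).

Lemma sum_kform e (u : W -> R) :
  \sum_y kform e (fun t => (t == y)%:R) * u y = kform e u.
Proof.
rewrite /kform; under eq_bigr => y _ do rewrite mulrDl.
by rewrite big_split; congr (_ + _); apply: sum_cobd_delta.
Qed.

Section Positivity.
Variable m : W -> E * bool.
Hypothesis fm : full_matching m.

Definition uncoupled (x y : W) : R :=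
  if is_root x then (x == y)%:R
  else match x with
       | inl _ => bsign (m x).2 * D (fun t => (inl t == y)%:R) (m x).1
       | inr _ => bsign (m x).2 * D' (fun t => (inr t == y)%:R) (m x).1
       end.

Lemma sum_kast (u : W -> R) x : ~~ is_root x ->
  \sum_y kast m x y * u y = bsign (m x).2 * kform (m x).1 u.
Proof.
move=> nx; rewrite /kast (negPf nx) -sum_kform mulr_sumr.
by apply: eq_bigr => y _; rewrite mulrA.
Qed.

Lemma sum_uncoupled (u : W -> R) x : ~~ is_root x ->
  \sum_y uncoupled x y * u y =
  match x with
  | inl _ => bsign (m x).2 * D (u \o inl) (m x).1
  | inr _ => bsign (m x).2 * D' (u \o inr) (m x).1
  end.
Proof.
move=> nx; rewrite /uncoupled (negPf nx); case: x nx => t _.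
  rewrite -sum_cobd_delta mulr_sumr; by apply: eq_bigr => y _; rewrite mulrA.
rewrite -sum_cobd_delta mulr_sumr; by apply: eq_bigr => y _; rewrite mulrA.
Qed.

Lemma fmx_segment (A B : W -> W -> R) t :
  fmx A + t *: (fmx B - fmx A) = fmx (fun x y => A x y + t * (B x y - A x y)).
Proof. by apply/matrixP=> i j; rewrite !mxE. Qed.

Lemma sum_segment (A B : W -> W -> R) t (u : W -> R) x :
  \sum_y (A x y + t * (B x y - A x y)) * u y =
  \sum_y A x y * u y + t * (\sum_y B x y * u y - \sum_y A x y * u y).
Proof.
rewrite mulrBr !mulr_sumr -sumrB -big_split; apply: eq_bigr => y _ /=; ring.
Qed.

(** Each nonroot equation reads (1 - t) u x + t (u x - u y) = 0 with y the other end of the edge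
    matched with x. So u y is nonzero when u x is: the support of u is stable under [along], hence
    empty by acyclicity, applied to the vertices and then dually to the faces. *)
Lemma uncoupled_inj (t : R) (u : W -> R) : 0 <= t <= 1 ->
  (forall x, \sum_y ((x == y)%:R + t * (uncoupled x y - (x == y)%:R)) * u y = 0) ->
  forall x, u x = 0.
Proof.
move=> t01 Ku0.
have mm := full_matchingP fm.
have seg x : ~~ is_root x -> u x + t * (\sum_y uncoupled x y * u y - u x) = 0.
  by move=> nx; rewrite -[RHS](Ku0 x) (sum_segment (fun x y => (x == y)%:R)) !sum_delta.
have u0 x : is_root x -> u x = 0.
  move=> rx; rewrite -[RHS](Ku0 x) (sum_segment (fun x y => (x == y)%:R)).
  rewrite /uncoupled rx !sum_delta.
  by rewrite subrr mulr0 addr0.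
case=> [v|f].
  apply/eqP; apply/negP=> /negP uv.
  pose Z : {set V} := [set v | u (inl v) != 0].
  have /setP/(_ v) : Z = set0; last by rewrite !inE uv.
  apply: (matching_acyclic plV plF mm); first by rewrite inE u0 /= ?eqxx.
  move=> a; rewrite !inE => ua; have na: a != v0.
    by apply: contraNneq ua => ->; rewrite u0 /=.
  have := seg (inl a) na; rewrite sum_uncoupled // cobd_half /= (mv_end mm na) /=.
  rewrite /along /= => E0; apply: contraNneq ua => ub; move: E0.
  by rewrite ub subr0 subrr mulr0 addr0 => ->.
apply/eqP; apply/negP=> /negP uf.
pose Z : {set F} := [set f | u (inr f) != 0].
have /setP/(_ f) : Z = set0; last by rewrite !inE uf.
apply: (matching_acyclic plF plV (matching_dual mm)); first by rewrite inE u0 /= ?eqxx.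
move=> a; rewrite !inE => ua; have na: a != r0.
  by apply: contraNneq ua => ->; rewrite u0 /=.
have := seg (inr a) na; rewrite sum_uncoupled // cobd_half /= (mf_end mm na) /=.
rewrite /along /= => E0; apply: contraNneq ua => ub; move: E0.
by rewrite ub subr0 subrr mulr0 addr0 => ->.
Qed.

Lemma coupled_inj (t : R) (u : W -> R) : 0 <= t <= 1 ->
  (forall x, \sum_y (uncoupled x y + t * (kast m x y - uncoupled x y)) * u y = 0) ->
  forall x, u x = 0.
Proof.
case/andP; rewrite le_eqVlt => /predU1P[<- _|t_gt0 t_le1] Ku0.
  apply: (@uncoupled_inj 1); first by rewrite ler01 lexx.
  move=> x; rewrite -[RHS](Ku0 x); apply: eq_bigr => y _; congr (_ * _); ring.
have [orth cV _ _] := plV; have [_ cF _ _] := plF.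
have u0 x : is_root x -> u x = 0.
  move=> rx; rewrite -[RHS](Ku0 x) sum_segment /kast /uncoupled rx !sum_delta.
  by rewrite subrr mulr0 addr0.
have seg e : D (u \o inl) e + t * D' (u \o inr) e = 0 \/
             t * D (u \o inl) e + D' (u \o inr) e = 0.
  case: fm => _ _ /(_ e)[x nx <-].
  have := Ku0 x; rewrite sum_segment sum_kast // sum_uncoupled //.
  move/(congr1 (fun a => bsign (m x).2 * a)); rewrite mulr0 /kform.
  case: x {nx} => x H; [left|right]; move: H; rewrite mulrDr mulrA bsignK mul1r.
    rewrite -mulrBr [t * (bsign _ * _)]mulrCA [bsign _ * (bsign _ * _)]mulrA
      bsignK mul1r => E0.
    by rewrite -[RHS]E0; ring.
  rewrite -mulrBr [t * (bsign _ * _)]mulrCA [bsign _ * (bsign _ * _)]mulrA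
      bsignK mul1r => E0.
  by rewrite -[RHS]E0; ring.
have uD e : D (u \o inl) e = 0.
  have pos e' : true -> 0 <= - (D (u \o inl) e' * D' (u \o inr) e').
    move=> _; case: (seg e') => /eqP; rewrite addr_eq0 => /eqP E0.
      by rewrite E0 mulNr opprK -mulrA mulr_ge0 ?(ltW t_gt0) // -expr2 sqr_ge0.
    move/eqP: E0; rewrite eq_sym eqr_oppLR => /eqP ->.
    by rewrite mulrN opprK mulrCA mulr_ge0 ?(ltW t_gt0) // -expr2 sqr_ge0.
  have s0 : \sum_e' - (D (u \o inl) e' * D' (u \o inr) e') = 0.
    by rewrite sumrN orth oppr0.
  have /(_ e isT)/eqP := psumr_eq0P pos s0; rewrite oppr_eq0 mulf_eq0.
  case/orP=> /eqP // D'0; case: (seg e); rewrite D'0 ?mulr0 addr0 //.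
  by move/eqP; rewrite mulf_eq0 gt_eqF //= => /eqP.
have uD' e : D' (u \o inr) e = 0.
  case: (seg e); rewrite uD ?mulr0 add0r // => /eqP.
  by rewrite mulf_eq0 gt_eqF //= => /eqP.
case=> [v|f].
  by have /= -> := cV _ uD v; rewrite u0 /=.
by have /= -> := cF _ uD' f; rewrite u0 /=.
Qed.

(* The identity is deformed first to the system without coupling between h and g,
   which is nonsingular by acyclicity, then to the whole system, which is
   nonsingular by orthogonality. *)
Lemma kast_det_gt0 : 0 < \det (fmx (kast m)).
Proof.
apply: (@det_segment_gt0 _ _ (fmx uncoupled)) => [t t01|].
  by rewrite fmx_segment; apply: fmx_det_neq0 => u; apply: coupled_inj.
apply: (@det_segment_gt0 _ _ (fmx (fun x y => (x == y)%:R))) => [t t01|].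
  by rewrite fmx_segment; apply: fmx_det_neq0 => u; apply: uncoupled_inj.
by rewrite fmx_id ltr01.
Qed.

End Positivity.

(** Flipping permutes k rows of [kast m] cyclically, with signature (-1)^(k-1), and rescales them by
    the product P of all half-edge signs. Both determinants are positive, so P (-1)^(k-1) = 1, and
    the k minus signs of the statement turn P into -1. *)
Lemma kasteleyn_cycle m (ps : seq (W * (E * bool))) :
  full_matching m -> ps != [::] -> uniq [seq p.1 | p <- ps] ->
  (forall p, p \in ps -> ~~ is_root p.1 && incident p.1 p.2) ->
  cycle (fun p q => p.2.1 == (m q.1).1) ps ->
  \prod_(p <- ps) (- (bsign p.2.2 * bsign (m p.1).2)) = -1 :> R.
Proof.
move=> fm ps0 Us pinc pcyc; pose xs := [seq p.1 | p <- ps].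
have x0 : W * (E * bool) by case: (ps) ps0.
(* The flipped matching: a vertex of the cycle takes the edge by which the cycle leaves it, which
   [m] assigns to the next vertex. *)
pose m' x := if x \in xs then (nth x0 ps (index x xs)).2 else m x.
have m'E p : p \in ps -> m' p.1 = p.2.
  move=> pp; rewrite /m' map_f //; congr (snd _).
  have ip : (index p ps < size ps)%N by rewrite index_mem.
  rewrite -{1}(nth_index x0 pp) -(nth_map x0 p.1) // index_uniq ?size_map //.
  by rewrite nth_index.
have xcyc : cycle (fun x y => (m' x).1 == (m y).1) xs.
  rewrite cycle_map; apply: sub_in_cycle pcyc; last by apply/allP => p pp; exact: pp.
  by move=> p q pp _ /=; rewrite m'E.
have m'next x : (m' x).1 = (m (next xs x)).1.
  case: (boolP (x \in xs)) => xx; first exact/eqP/(next_cycle xcyc).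
  by rewrite /m' next_nth (negPf xx).
have rnext x : ~~ is_root x -> ~~ is_root (next xs x).
  case: (boolP (x \in xs)) => xx; last by rewrite next_nth (negPf xx).
  have: next xs x \in xs by rewrite mem_next.
  by case/mapP=> p /pinc/andP[pn _] ->.
have rprev x : ~~ is_root x -> ~~ is_root (prev xs x).
  case: (boolP (x \in xs)) => xx; last by rewrite prev_nth (negPf xx).
  have: prev xs x \in xs by rewrite mem_prev.
  by case/mapP=> p /pinc/andP[pn _] ->.
have fm' : full_matching m'.
  case: fm => inc inj surj; split.
  - move=> x nx; case: (boolP (x \in xs)) => [/mapP[p pp ->]|xx].
      by rewrite m'E //; case/andP: (pinc p pp).
    by rewrite /m' (negPf xx) inc.
  - move=> x y nx ny; rewrite !m'next => /inj-/(_ (rnext _ nx) (rnext _ ny)).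
    exact: (can_inj (prev_next Us)).
  move=> e; case: (surj e) => x nx xe; exists (prev xs x); first exact: rprev.
  by rewrite m'next next_prev.
pose a x : R := if x \in xs then bsign (m' x).2 * bsign (m (next xs x)).2 else 1.
have kE : fmx (kast m') = fmx (fun x y => a x * kast m (next xs x) y).
  apply/matrixP=> i j; rewrite !mxE; move: (enum_val i) (enum_val j) => x y.
  case: (boolP (x \in xs)) => xx.
    have nx: ~~ is_root x by case/mapP: (xx) => p /pinc/andP[pn _] ->.
    rewrite /kast /a xx (negPf nx) (negPf (rnext _ nx)) m'next.
    by rewrite -!mulrA; congr (_ * _); rewrite mulrA bsignK mul1r.
  by rewrite /kast /a /m' next_nth (negPf xx) mul1r.
have xs0 : xs != [::] by rewrite /xs; case: (ps) ps0.
have := kast_det_gt0 fm'; rewrite kE det_fmx_scale det_fmx_next //.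
rewrite mulrA pmulr_lgt0; last exact: kast_det_gt0.
have -> : \prod_x a x = \prod_(p <- ps) (bsign p.2.2 * bsign (m p.1).2).
  have -> : \prod_x a x = \prod_(x <- xs) (bsign (m' x).2 * bsign (m (next xs x)).2).
    rewrite [RHS]big_uniq //= [LHS](bigID (mem xs)) /= [X in _ * X]big1 ?mulr1.
      by apply: eq_bigr => x xx; rewrite /a xx.
    by move=> x /negPf xx; rewrite /a xx.
  rewrite big_split [RHS]big_split; congr (_ * _).
    by rewrite big_map; apply: eq_big_seq => p pp; rewrite m'E.
  rewrite -(big_map (next xs) xpredT (fun x => bsign (m x).2)).
  rewrite -[RHS](big_map fst xpredT (fun x => bsign (m x).2)).
  apply: perm_big; apply: uniq_perm => //.
    by rewrite map_inj_uniq //; apply: can_inj (prev_next Us).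
  move=> x; apply/mapP/idP => [[y yx ->]|xx]; first by rewrite mem_next.
  by exists (prev xs x); rewrite ?mem_prev ?next_prev.
set P := \prod_(_ <- _) _ => Pgt0.
have PP : P * P = 1.
  by rewrite -big_split /= big1 // => p _; rewrite mulrACA !bsignK mulr1.
have -> : \prod_(p <- ps) - (bsign p.2.2 * bsign (m p.1).2) = (-1) ^+ size xs * P.
  rewrite /P size_map; elim: (ps) => [|p s IHs]; first by rewrite !big_nil mulr1.
  by rewrite !big_cons IHs /= exprS; ring.
have: P * (-1) ^+ (size xs).-1 = 1.
  set Q := P * _ in Pgt0 *; have: Q ^+ 2 = 1.
    by rewrite exprMn expr2 PP mul1r -exprM mulnC exprM sqrrN !expr1n.
  move/eqP; rewrite sqrf_eq1 => /orP[/eqP//|/eqP Q1].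
  by rewrite Q1 oppr_gt0 ltr10 in Pgt0.
case: (size xs) (size_eq0 xs) => [|k] /=; first by rewrite (negPf xs0).
by move=> _; rewrite exprS mulN1r mulNr mulrC => ->.
Qed.

End Kasteleyn.

(** * From the disk to the sphere *)

Lemma connect_inv (T : finType) (e : rel T) (P : T -> Prop) x y :
  (forall a b, e a b -> P a -> P b) -> connect e x y -> P x -> P y.
Proof.
move=> eP /connectP[p + ->]; elim: p x => //= z p IHp x /andP[xz zp] Px.
exact: IHp zp (eP _ _ xz Px).
Qed.

Lemma val_ord_pred n (i : 'I_n) : (0 < i)%N -> ord_pred i = i.-1 :> nat.
Proof.
move=> i_gt0; have := ltn_ord i => lin /=.
have -> : (i + n).-1 = (i.-1 + n)%N by lia.
by rewrite modnDr modn_small //; lia.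
Qed.

Section DiskFaces.
Variables (n : nat) (G : diskmap n).
Hypothesis planarG : planar_disk G.
Implicit Types (d : dart G) (v : vert G) (x y : hedge G) (i : 'I_n).

Lemma rotd_inj : injective (@rotd n G).
Proof. by case: planarG => _ []. Qed.

Lemma fconnect_rotd d d' : fconnect (@rotd n G) d d' = (dtail d == dtail d').
Proof. by case: planarG => _ []. Qed.

Lemma dtail_prev d : dtail (finv (@rotd n G) d) = dtail d.
Proof. by apply/esym/eqP; rewrite -fconnect_rotd fconnect_finv. Qed.

Lemma flipK : involutive (@flip n G).
Proof. by case=> e b; rewrite /flip /= negbK. Qed.

Lemma face_inj : injective (@face n G).
Proof. by move=> d d' /(finv_inj rotd_inj)/(can_inj flipK). Qed.

Lemma prev_face d : finv (@rotd n G) d = face (flip d).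
Proof. by rewrite /face flipK. Qed.

Lemma dtail_face d : dtail (face d) = dhead d.
Proof. by rewrite /face dtail_prev. Qed.

Lemma face_outer i : face (inr i, false) = (inr (ordS i), false) :> dart G.
Proof.
apply: rotd_inj; rewrite /face (f_finv rotd_inj).
by case: planarG => _ _ _ -> _.
Qed.

Definition outer d : bool := if d is (inr _, false) then true else false.

Lemma outer_face d : outer (face d) = outer d.
Proof.
apply/idP/idP => [|]; last by case: d => [[e|i] []] //; rewrite face_outer.
case E: (face d) => [[e|i] []] //= _.
by move: E; rewrite -[i]ord_predK -face_outer => /face_inj ->.
Qed.

(* The disk face at the corner that follows d counterclockwise; for the outward
   corner of an arc this is the face on the inner side of the arc. *)
Definition hedge_of d : hedge G :=
  match d with (inl e, b) => inl (e, b) | (inr i, _) => inr i end.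

Definition corner d : disk_face G := face_of (hedge_of d).

Lemma hedge_ofK x : hedge_of (fdart x) = x.
Proof. by case: x => [[e b]|i]. Qed.

Lemma fdartK d : ~~ outer d -> fdart (hedge_of d) = d.
Proof. by case: d => [[e|i] []]. Qed.

Lemma face_ofE x y :
  (face_of x == face_of y) = fconnect (@face n G) (fdart x) (fdart y).
Proof.
apply/idP/idP => [/eqP/(congr1 val)/= /setP/(_ (fdart y))|xy].
  by rewrite !inE connect0 => ->.
apply/eqP/val_inj/setP => d; rewrite /= !inE.
by apply: same_connect xy d; apply: fconnect_sym face_inj.
Qed.

Lemma corner_face d : ~~ outer d -> corner (face d) = corner d.
Proof.
move=> od; apply/esym/eqP; rewrite /corner face_ofE !fdartK ?outer_face //.
exact: fconnect1.
Qed.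

Lemma corner_prev d : corner (finv (@rotd n G) d) =
  match d with
  | (inl e, b) => face_of (inl (e, ~~ b))
  | (inr i, b) => face_of (inr (if b then ordS i else i))
  end.
Proof.
rewrite prev_face; case: d => [[e|i] []]; rewrite /flip /=.
- by rewrite corner_face.
- by rewrite corner_face.
- by rewrite face_outer.
by rewrite corner_face.
Qed.

Lemma disk_faceP (f : disk_face G) : exists x, f = face_of x.
Proof.
by case: f => F /[dup] /imsetP[x _ ->] p; exists x; apply: val_inj.
Qed.

Section Divergence.
Variables (R : realFieldType) (g : disk_face G -> R).

(** The variations of [g] from corner to corner around v telescope. Both arcs at a boundary vertex
    lead to the outside, whose corner is given the value of an inner face, so that together they
    account for the jump from one arc to the next. *)
Lemma face_divergence v :
  \sum_(d : edge G * bool | endpt d.1 d.2 == v)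
     (g (face_of (inl d)) - g (face_of (inl (d.1, ~~ d.2))))
  + \sum_(i | bdv G i == v)
     (g (face_of (inr (ord_pred i))) - g (face_of (inr i))) = 0.
Proof.
pose rot' := finv (@rotd n G).
have rot'_inj : injective rot' := finv_inj rotd_inj.
have tot : \sum_(d | dtail d == v) (g (corner d) - g (corner (rot' d))) = 0.
  rewrite sumrB; apply/eqP; rewrite subr_eq0; apply/eqP.
  rewrite (reindex_inj rot'_inj) /=; apply: eq_bigl => d.
  by rewrite dtail_prev.
rewrite -[RHS]tot.
have -> : \sum_(d | dtail d == v) (g (corner d) - g (corner (rot' d))) =
    \sum_(a : edge G + 'I_n) \sum_(b : bool | dtail ((a, b) : dart G) == v)
       (g (corner (a, b)) - g (corner (rot' (a, b)))).
  by rewrite pair_big_dep; apply: eq_big => -[a b].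
rewrite big_sumType /=; congr (_ + _).
  rewrite pair_big_dep /=; apply: eq_big => -[e b] //= _.
  by rewrite /rot' corner_prev.
rewrite (reindex_inj (can_inj (@ordSK n))) big_mkcond /=; apply: eq_bigr => i _.
rewrite [RHS]big_mkcond /= big_bool /= /rot' !corner_prev /corner /= ordSK.
by rewrite subrr !if_same addr0.
Qed.

End Divergence.

Section Sphere.
Variables (i0 j : 'I_n) (i0E : i0 = 0%N :> nat).

(* Two new vertices are placed outside the disk, inr true joined to the boundary
   vertices 1, ..., j by the legs and inr false to the other boundary vertices.
   They are joined by two parallel edges that enclose the new face None. *)
Definition sphere_vert : finType := (vert G + bool)%type.
Definition sphere_face : finType := option (disk_face G).
Definition sphere_edge : finType := ((edge G + 'I_n) + bool)%type.

Definition star i : bool := (0 < i <= j)%N.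

Definition vend (e : sphere_edge) (b : bool) : sphere_vert :=
  match e with
  | inl (inl e) => inl (endpt e b)
  | inl (inr i) => if b then inl (bdv G i) else inr (star i)
  | inr _ => inr b
  end.

Definition fend (e : sphere_edge) (b : bool) : sphere_face :=
  match e with
  | inl (inl e) => Some (face_of (inl (e, b)))
  | inl (inr i) => Some (face_of (inr (if b then ord_pred i else i)))
  | inr false => if b then Some (face_of (inr i0)) else None
  | inr true => if b then None else Some (face_of (inr j))
  end.

Section Values.
Variable R : realFieldType.

Lemma sum_arcs_telescope (a : 'I_n -> R) :
  \sum_(i | star i) (a (ord_pred i) - a i) = a i0 - a j.
Proof.
suff main m (lt_mn : (m < n)%N) :
    \sum_(i : 'I_n | (0 < i <= m)%N) (a (ord_pred i) - a i) = a i0 - a (Ordinal lt_mn).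
  by rewrite (main j (ltn_ord j)); congr (_ - a _); apply: val_inj.
elim: m lt_mn => [|m IHm] lt_mn.
  rewrite big_pred0 => [|i]; last by lia.
  by rewrite (_ : Ordinal lt_mn = i0) ?subrr //; apply: val_inj; rewrite /= i0E.
have lt_mn' := ltnW lt_mn.
rewrite (bigD1 (Ordinal lt_mn)) /=; last by rewrite leqnn.
rewrite (eq_bigl (fun i : 'I_n => (0 < i <= m)%N)) => [|i]; last first.
  by rewrite -val_eqE /=; lia.
rewrite (IHm lt_mn') (_ : ord_pred _ = Ordinal lt_mn'); last first.
  by apply: ord_inj; rewrite val_ord_pred.
by rewrite addrC addrA subrK.
Qed.

(** Summation by parts: the edges of the graph cancel the vertex ends of the legs by
    [face_divergence]. The star ends telescope to the variation of [g] from arc [i0] to arc [j],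
    which is the variation across the two extra edges taken together. *)
Lemma sphere_orth (h : sphere_vert -> R) (g : sphere_face -> R) :
  \sum_e cobd vend h e * cobd fend g e = 0.
Proof.
pose gF i := g (Some (face_of (inr i))).
pose gE e b := g (Some (face_of (inl (e, b)))).
rewrite big_sumType big_sumType /= big_bool /= /cobd /=.
have -> : \sum_e (h (inl (endpt e true)) - h (inl (endpt e false))) *
              (g (Some (face_of (inl (e, true)))) - g (Some (face_of (inl (e, false)))))
  = - \sum_i h (inl (bdv G i)) * (gF (ord_pred i) - gF i).
  transitivity (\sum_(d : edge G * bool) h (inl (endpt d.1 d.2)) *
                  (gE d.1 d.2 - gE d.1 (~~ d.2))).
    rewrite -(pair_bigA _ (fun e b => h (inl (endpt e b)) * (gE e b - gE e (~~ b)))) /=.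
    by apply: eq_bigr => e _; rewrite big_bool /= /gE; ring.
  apply/eqP; rewrite -addr_eq0; apply/eqP.
  rewrite (partition_big (fun d : edge G * bool => endpt d.1 d.2) xpredT) //=.
  rewrite [X in _ + X](partition_big (bdv G) xpredT) //= -big_split big1 //= => v _.
  have := congr1 (GRing.mul (h (inl v))) (face_divergence (fun f => g (Some f)) v).
  rewrite mulr0 mulrDr => div0; rewrite -[RHS]div0.
  congr (_ + _); rewrite mulr_sumr; first by apply: eq_bigr => -[e b] /eqP /= <-.
  by apply: eq_bigr => i /eqP <-.
have cyc : \sum_i (gF (ord_pred i) - gF i) = 0.
  rewrite sumrB [X in X - _](reindex_inj (can_inj (@ordSK n))) /=.
  by under eq_bigr => i _ do rewrite ordSK; rewrite subrr.
have -> : \sum_i (h (inl (bdv G i)) - h (inr (star i))) *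
      (g (Some (face_of (inr (ord_pred i)))) - g (Some (face_of (inr i)))) =
    \sum_i h (inl (bdv G i)) * (gF (ord_pred i) - gF i)
    - (h (inr true) - h (inr false)) * (gF i0 - gF j).
  rewrite -(sum_arcs_telescope gF) [X in _ = _ - _ * X]big_mkcond mulr_sumr /=.
  transitivity (\sum_i h (inl (bdv G i)) * (gF (ord_pred i) - gF i)
     - \sum_i (h (inr true) - h (inr false)) *
         (if star i then gF (ord_pred i) - gF i else 0)
     - h (inr false) * \sum_i (gF (ord_pred i) - gF i)).
    rewrite mulr_sumr -!sumrB; apply: eq_bigr => i _; rewrite /gF.
    by case: (star i); ring.
  by rewrite cyc mulr0 subr0.
by rewrite /gF; ring.
Qed.

Lemma cobd_eq (X Y : finType) (ends : Y -> bool -> X) (a : X -> R) e b b' :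
  cobd ends a e = 0 -> a (ends e b) = a (ends e b').
Proof. by move/eqP; rewrite subr_eq0 => /eqP; case: b; case: b'. Qed.

Lemma sphere_vert_connected (h : sphere_vert -> R) (s : bool) :
  (forall e, cobd vend h e = 0) -> forall p, h p = h (inr s).
Proof.
move=> Dh; have stars b : h (inr b) = h (inr s).
  exact: (cobd_eq b s (Dh (inr true))).
have bd i : h (inl (bdv G i)) = h (inr s).
  by rewrite (cobd_eq true false (Dh (inl (inr i)))) stars.
case=> [v|b]; last exact: stars.
have [_ _ conn _ _] := planarG.
pose P v := h (inl v) = h (inr s).
suff: P v by [].
apply: (connect_inv (P := P) _ (conn (bdv G i0) v)); last exact: bd.
move=> x y /existsP[d /andP[/eqP <- /eqP <-]].
case: d => [[e|i] b]; rewrite /P /dhead /flip /= => <-; last by rewrite !bd.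
exact: (cobd_eq (~~ b) b (Dh (inl (inl e)))).
Qed.

Lemma corner_const_at (g : disk_face G -> R) v :
  (forall e b, endpt e b = v ->
     g (face_of (inl (e, b))) = g (face_of (inl (e, ~~ b)))) ->
  (forall i, bdv G i = v -> g (face_of (inr (ord_pred i))) = g (face_of (inr i))) ->
  forall d d', dtail d = v -> dtail d' = v -> g (corner d) = g (corner d').
Proof.
move=> gE gB d d' dv d'v.
have: fconnect (@rotd n G) d' d by rewrite fconnect_rotd dv d'v.
rewrite -(same_fconnect_finv rotd_inj).
pose P a := dtail a = v /\ g (corner a) = g (corner d').
move=> dd'; suff: P d by case.
apply: (connect_inv (P := P) _ dd') => // a b /eqP <- [av ga]; rewrite /P dtail_prev av -ga.
split=> //; rewrite corner_prev; case: a av {ga} => [[e|i] c] /= av.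
- by rewrite (gE e c).
by case: c av => // /gB; rewrite ordSK.
Qed.

Lemma sphere_face_connected (g : sphere_face -> R) :
  (forall e, cobd fend g e = 0) -> forall f, g f = g None.
Proof.
move=> Dg; have g0 : g (Some (face_of (inr i0))) = g None.
  exact: (cobd_eq true false (Dg (inr false))).
case=> // f; have [x ->] := disk_faceP f; rewrite -{}g0.
pose g' f := g (Some f).
have const v := @corner_const_at g' v
  (fun e b _ => cobd_eq b (~~ b) (Dg (inl (inl e))))
  (fun i _ => cobd_eq true false (Dg (inl (inr i)))).
pose P v := forall d, dtail d = v -> g' (corner d) = g' (corner (inr i0, false)).
have [_ _ conn _ _] := planarG.
have PP v : P v.
  apply: (connect_inv (P := P) _ (conn (bdv G i0) v)); last first.
    by move=> d dv; apply: const dv _.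
  move=> a b /existsP[d /andP[/eqP da /eqP db]] Pa d' d'b.
  rewrite (const b _ (flip d)) // -[RHS](Pa d) //.
  case: (d) => [[e|i] c] //; exact: (cobd_eq (~~ c) c (Dg (inl (inl e)))).
by have := PP _ (fdart x) erefl; rewrite /corner hedge_ofK.
Qed.

Lemma star_faces (g : sphere_face -> R) (s : bool) :
  (forall e b, vend e b = inr s -> cobd fend g e = 0) ->
  forall e b, vend e b = inr s -> g (fend e true) = g None.
Proof.
move=> Dg; have Dg' b : cobd fend g (inr b) = 0 by apply: (Dg _ s).
pose gF i := g (Some (face_of (inr i))).
have g0 : gF i0 = g None := cobd_eq true false (Dg' false).
have gj : gF j = g None := cobd_eq false true (Dg' true).
have leg i : star i = s -> gF (ord_pred i) = gF i.
  by move=> is_s; apply: (cobd_eq true false (Dg (inl (inr i)) false _)); rewrite /= is_s.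
case=> [[e|i]|[]] b //=.
case: b => // -[is_s]; rewrite -/(gF _) leg //.
(* Descend along consecutive legs of one star. The star changes only at arcs [i0] and [j], and there
   an extra edge leads to the face [None]. *)
have arcs k (i' : 'I_n) : i' = k :> nat -> star i' = s -> gF i' = g None.
  elim: k i' => [|k IHk] i' i'E i's.
    by rewrite (_ : i' = i0) //; apply: ord_inj; rewrite i'E i0E.
  have pE : ord_pred i' = k :> nat by rewrite val_ord_pred i'E.
  rewrite -leg //; case: (eqVneq (star (ord_pred i')) s) => [ps|].
    exact: IHk.
  rewrite -i's /star pE i'E => ne.
  have : (k = 0)%N \/ k = j by move: ne; lia.
  case=> kE; [rewrite (_ : ord_pred i' = i0)|rewrite (_ : ord_pred i' = j)] => //.
    by apply: ord_inj; rewrite pE i0E.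
  by apply: ord_inj; rewrite pE.
exact: (arcs i).
Qed.

Lemma sphere_vert_link (g : sphere_face -> R) (p : sphere_vert) :
  (forall e b, vend e b = p -> cobd fend g e = 0) ->
  forall e b e' b', vend e b = p -> vend e' b' = p ->
  g (fend e true) = g (fend e' true).
Proof.
case: p => [v|s] Dg e b e' b' ep e'p; last first.
  by rewrite (star_faces Dg ep) (star_faces Dg e'p).
have const := @corner_const_at (fun f => g (Some f)) v.
have {}const := const (fun a c av => cobd_eq c (~~ c)
  (Dg (inl (inl a)) c (congr1 inl av))).
have {}const := const (fun i iv => cobd_eq true false
  (Dg (inl (inr i)) true (congr1 inl iv))).
have side a c : vend a c = inl v ->
    exists2 d, dtail d = v & g (fend a true) = g (Some (corner d)).
  case: a => [[a|i]|//] /= => [ac|].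
    exists (inl a, c); first by case: ac.
    exact: (cobd_eq true c (Dg (inl (inl a)) c ac)).
  case: c => // iv; exists (inr i, false); first by case: iv.
  exact: (cobd_eq true false (Dg (inl (inr i)) true iv)).
have [d dv ->] := side _ _ ep; have [d' d'v ->] := side _ _ e'p.
exact: const.
Qed.

Lemma star_ordS i : i <> i0 -> i <> j -> star (ordS i) = star i.
Proof.
move=> ni0 nj; have lt_in := ltn_ord i; have lt_jn := ltn_ord j.
have ni0' : i <> 0%N :> nat by move=> iE; apply: ni0; apply: ord_inj; rewrite iE i0E.
have nj' : i <> j :> nat by move=> /ord_inj.
rewrite /star /=; case: (ltngtP i.+1 n) => [lt|gt|eq].
- by rewrite modn_small //; lia.
- lia.
by rewrite eq modnn; lia.
Qed.

Lemma sphere_face_link (h : sphere_vert -> R) (f : sphere_face) :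
  (forall e b, fend e b = f -> cobd vend h e = 0) ->
  forall e b e' b', fend e b = f -> fend e' b' = f ->
  h (vend e true) = h (vend e' true).
Proof.
case: f => [f|] Dh; last by move=> [[e|i]|?] b [[e'|i']|?] b'.
have [x fE] := disk_faceP f.
have Dn a b c c' : fend a b = Some f -> h (vend a c) = h (vend a c').
  by move=> ab; apply: cobd_eq (Dh _ _ ab).
have legs i : face_of (inr i) = f -> h (inl (bdv G i)) = h (inr (star i)).
  by move=> iF; apply: (Dn (inl (inr i)) false true false); rewrite /= iF.
have legs' i : face_of (inr i) = f -> h (inl (bdv G (ordS i))) = h (inr (star (ordS i))).
  by move=> iF; apply: (Dn (inl (inr (ordS i))) true true false); rewrite /= ordSK iF.
have stars i : face_of (inr i) = f -> i = i0 \/ i = j -> h (inr true) = h (inr false).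
  move=> iF [] ie; subst i.
    by apply: (Dn (inr false) true true false); rewrite /= iF.
  by apply: (Dn (inr true) false true false); rewrite /= iF.
(* The arc is bypassed through the legs at its two ends. They meet in the same star unless the arc
   is [i0] or [j], where an extra edge bordering the same face joins the two stars. *)
have arcs i : face_of (inr i) = f -> h (inl (bdv G (ordS i))) = h (inl (bdv G i)).
  move=> iF; rewrite legs' // legs //.
  case: (eqVneq i i0) => [ie|/eqP ni0].
    by have := stars i iF (or_introl ie); case: (star _); case: (star _).
  case: (eqVneq i j) => [ie|/eqP nj]; last by rewrite star_ordS.
  by have := stars i iF (or_intror ie); case: (star _); case: (star _).
have step d : ~~ outer d -> corner d = f ->
    h (inl (dtail (face d))) = h (inl (dtail d)).
  rewrite dtail_face; case: d => [[e|i] b] //= od df.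
    apply: (Dn (inl (inl e)) b (~~ b) b); by rewrite /= -df.
  by case: b od df => // _ df; rewrite /dhead /= -arcs.
have const d : ~~ outer d -> corner d = f ->
    h (inl (dtail d)) = h (inl (dtail (fdart x))).
  move=> od df; have: fconnect (@face n G) (fdart x) d.
    by rewrite -(fdartK od) -face_ofE -fE -df.
  pose P a := [/\ ~~ outer a, corner a = f & h (inl (dtail a)) = h (inl (dtail (fdart x)))].
  move=> xd; suff: P d by case.
  apply: (connect_inv (P := P) _ xd) => [a b /eqP <- [oa af ha]|]; last first.
    by split=> //; [case: (x) => [[]|]|rewrite /corner hedge_ofK].
  by split; rewrite ?outer_face ?corner_face ?step.
suff val a b : fend a b = Some f -> h (vend a true) = h (inl (dtail (fdart x))).
  by move=> e b e' b' /val -> /val ->.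
case: a => [[e|i]|[]] /=.
- move=> [ef]; rewrite -(const (inl e, b)) //.
  by apply: (Dn (inl (inl e)) b true b); rewrite /= ef.
- case: b => -[iF].
    by rewrite -(const (inr (ord_pred i), true)) //= ord_predK.
  by rewrite -(const (inr i, true)) //= arcs.
- case: b => // -[jF]; have := stars j jF (or_intror erefl) => st.
  rewrite -(const (inr j, true)) //= arcs // legs //; by case: (star j).
case: b => // -[iF]; have := stars i0 iF (or_introl erefl) => st.
rewrite -(const (inr i0, true)) //= arcs // legs //; by case: (star i0).
Qed.

Lemma sphere_planar (s : bool) :
  half_planar R vend fend (inr s) None /\ half_planar R fend vend None (inr s).
Proof.
split; split.
- exact: sphere_orth.
- by move=> h Dh v; apply: sphere_vert_connected.
- by move=> v g Dg e b e' b'; apply: sphere_vert_link.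
- by move=> g Dg e b; apply: star_faces.
- move=> g h; rewrite -[RHS](sphere_orth h g); apply: eq_bigr => e _; exact: mulrC.
- exact: sphere_face_connected.
- by move=> f h Dh e b e' b'; apply: sphere_face_link.
move=> h Dh [[e|i]|c] b //= eb.
exact: (cobd_eq true s (Dh (inr c) b eb)).
Qed.

End Values.
End Sphere.
End DiskFaces.

(** * Signs in the Temperley graph *)

Lemma double_ord_inj n (i i' : 'I_n) b b' :
  double_ord i b = double_ord i' b' -> i = i' /\ b = b'.
Proof.
move/(congr1 val); rewrite /= => E.
have bb' : b = b' by case: b E; case: b' => //=; lia.
by split=> //; apply: ord_inj; move: E; rewrite bb'; lia.
Qed.

Section Orientation.
Variables (n : nat) (G : diskmap n).
Hypothesis planarG : planar_disk G.
Variables (i0 : 'I_n) (i0E : i0 = 0%N :> nat).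
Variable O : edge (temperley G) -> bool.
Hypothesis O_perfect : perfect O (@nd_white n G).
Hypothesis O_sources : sources O = O2_sources n.

Local Notation T := (temperley G).
Local Notation tail y := (dtail (odart O y)).
Local Notation head y := (dhead (odart O y)).
Implicit Types (y : edge T) (C : seq (edge T)).

Definition white_end y : vert G + disk_face G :=
  let: (x, s) := y in if s then inl (dtail (vdart x)) else inr (face_of x).

Lemma tailE y : tail y = if O y then inr (white_end y) else nd_black_end y.
Proof. by case: y => [x s]; rewrite /odart /= /nd_endpt; case: (O _). Qed.

Lemma headE y : head y = if O y then nd_black_end y else inr (white_end y).
Proof. by case: y => [x s]; rewrite /odart /dhead /= /nd_endpt; case: (O _). Qed.

Lemma black_endP y (p : vert G + disk_face G) : nd_black_end y <> inr p.
Proof. by case: y => [[[e b]|i] s]. Qed.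

Lemma white_interior p : interior (inr p : vert T).
Proof. by apply/codomP => -[c]. Qed.

Lemma in_edge_ex p : exists y, ~~ O y && (white_end y == p).
Proof.
have := O_perfect (white_interior p); rewrite /= => /eqP/cards1P[y /setP/(_ y)].
rewrite !inE eqxx headE; case: ifP => [_ /eqP/black_endP//|/negbT Oy /eqP[ye]].
by exists y; rewrite Oy ye eqxx.
Qed.

Definition in_edge p : edge T := xchoose (in_edge_ex p).

Lemma in_edgeP p : O (in_edge p) = false /\ white_end (in_edge p) = p.
Proof. by have /andP[/negPf -> /eqP ->] := xchooseP (in_edge_ex p). Qed.

Lemma in_edgeE y : O y = false -> in_edge (white_end y) = y.
Proof.
move=> Oy; have := O_perfect (white_interior (white_end y)).
rewrite /= => /eqP/cards1P[y' /setP y'E].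
have [Oi ie] := in_edgeP (white_end y).
have := y'E y; have := y'E (in_edge (white_end y)).
by rewrite !inE !headE Oi Oy ie eqxx => /esym/eqP -> /esym/eqP ->.
Qed.

Lemma out_edge_ex e : exists y, O y = false /\ nd_black_end y = inl (inr e).
Proof.
have ie : interior (inl (inr e) : vert T) by apply/codomP => -[c].
have /eqP/cards1P[y /setP/(_ y)] :
  #|[set y | tail y == inl (inr e)]| = 1%N := O_perfect ie.
rewrite !inE eqxx tailE; case: ifP => // Oy /eqP ye; by exists y.
Qed.

Lemma out_edge_uniq e y y' : O y = false -> O y' = false ->
  nd_black_end y = inl (inr e) -> nd_black_end y' = inl (inr e) -> y = y'.
Proof.
move=> Oy Oy' ye y'e.
have ie : interior (inl (inr e) : vert T) by apply/codomP => -[c].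
have /eqP/cards1P[z /setP zE] :
  #|[set y | tail y == inl (inr e)]| = 1%N := O_perfect ie.
have := zE y; have := zE y'; rewrite !inE !tailE Oy Oy' ye y'e eqxx.
by move=> /esym/eqP -> /esym/eqP ->.
Qed.

Lemma black_boundary y c : nd_black_end y = inl (inl c) ->
  exists i s, y = (inr i, s) /\ c = double_ord i (~~ s).
Proof. by case: y => [[[e b]|i] s] //= [<-]; exists i, s. Qed.

Lemma boundary_edge_uniq y y' c :
  nd_black_end y = inl (inl c) -> nd_black_end y' = inl (inl c) -> y = y'.
Proof.
move=> /black_boundary[i [s [-> ->]]] /black_boundary[i' [s' [-> /double_ord_inj[-> /eqP]]]].
by rewrite (inj_eq negb_inj) => /eqP ->.
Qed.

Lemma O_boundary i s : O (inr i, s) = ~~ s && (i != i0).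
Proof.
have src : (double_ord i (~~ s) \in sources O) = ~~ O (inr i, s).
  rewrite inE; apply/existsP/idP => [[y]|/negPf Oy]; last first.
    by exists (inr i, s); rewrite tailE Oy.
  rewrite tailE; case: ifP => // Oy /eqP /black_boundary[i' [s' [yE]]].
  case/double_ord_inj=> ii' /(congr1 negb); rewrite !negbK => ss'.
  by rewrite ii' ss' -yE Oy.
rewrite -[LHS]negbK -src O_sources inE /=.
have -> : (i == i0) = (i == 0%N :> nat) by rewrite -i0E.
by case: s {src} => /=; lia.
Qed.

Lemma walk_step y y' : head y = tail y' ->
  O y' = ~~ O y /\
  (if O y then exists e, nd_black_end y = inl (inr e) /\ nd_black_end y' = inl (inr e)
   else white_end y' = white_end y).
Proof.
rewrite headE tailE; case Oy: (O y); case Oy': (O y') => //=.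
- by move=> /black_endP.
- case E: (nd_black_end y) => [[c|e]|p] yy'; [|by split=> //; exists e|by case: (@black_endP y p)].
  by move: Oy Oy'; rewrite (boundary_edge_uniq E (esym yy')) => ->.
- by move=> [->].
by move=> /esym/black_endP.
Qed.

(* A boundary edge stands for the end of a leg, or for the side of one of the two
   edges outside the disk, that it becomes on the sphere. *)
Definition half_side y : bool :=
  let: (x, s) := y in
  match x with inl (_, b) => b | inr i => s || (i == i0) end.

Definition edge_sign y : int := bsign (O y) * bsign (half_side y).

Section Closure.
Variables (j : 'I_n) (nr : bool).
Local Notation W := (sphere_vert G + sphere_face G)%type.
Local Notation E := (sphere_edge G).
Local Notation root := (@is_root _ _ (inr (~~ nr) : sphere_vert G) (None : sphere_face G)).
Local Notation inc := (incident (@vend n G j) (@fend n G i0 j)).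

Definition half y : E * bool :=
  let: (x, s) := y in
  (match x with
   | inl (e, _) => inl (inl e)
   | inr i => if s then inl (inr i) else inr (i != i0)
   end, half_side y).

Definition emb (p : vert G + disk_face G) : W :=
  match p with inl v => inl (inl v) | inr f => inr (Some f) end.

(* inl (inr nr) is the new vertex that is not the root, and it is matched with the
   edge that a path ending at the j-th face runs along to close up. *)
Definition temperley_matching (x : W) : E * bool :=
  match x with
  | inl (inl v) => half (in_edge (inl v))
  | inr (Some f) => half (in_edge (inr f))
  | _ => (inr true, nr)
  end.

Lemma emb_inj : injective emb. Proof. by case=> [v|f] [v'|f'] //= [->]. Qed.

Lemma matching_emb p : temperley_matching (emb p) = half (in_edge p).
Proof. by case: p. Qed.

Lemma root_emb p : root (emb p) = false. Proof. by case: p. Qed.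

(** Every sink edge is sent to the extra edge [inr true], which borders the face of arc [j]; the
    hypothesis therefore restricts the sinks to the j-th. *)
Lemma half_inc y : (O y -> forall i, y = (inr i, false) -> i = j) ->
  inc (emb (white_end y)) (half y).
Proof.
case: y => [[[e b]|i] [|]] //= ij.
move: ij; rewrite O_boundary /=; case: eqP => [-> _ //|/= _ /(_ isT i erefl) ->].
by rewrite eqxx.
Qed.

Lemma half_inj y y' : O y = false -> O y' = false -> (half y).1 = (half y').1 -> y = y'.
Proof.
case: y => [[[e b]|i] s]; case: y' => [[[e' b']|i'] s'] Oy Oy' /=.
- by case=> ee'; apply: (@out_edge_uniq e); rewrite //= ee'.
- by case: s' Oy'.
- by case: s Oy.
move: Oy Oy'; rewrite !O_boundary; case: s; case: s' => //=.
  by move=> _ _ [->].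
by move=> /negbFE/eqP -> /negbFE/eqP ->.
Qed.

Lemma half_neq y : O y = false -> (half y).1 <> inr true.
Proof.
case: y => [[[e b]|i] [|]] //=; rewrite O_boundary /= => /negbFE/eqP ->.
by rewrite eqxx.
Qed.

(** Each white vertex is matched with its unique incoming edge. The legs are taken by the sources
    with odd labels and [inr false] by the source with label 2, which leaves [inr true] to the new
    vertex that is not a root. *)
Lemma temperley_full_matching :
  full_matching (@vend n G j) (@fend n G i0 j) (inr (~~ nr)) None temperley_matching.
Proof.
have nonroot x : ~~ root x -> (exists p, x = emb p) \/ x = inl (inr nr).
  case: x => [[v|b]|[f|]] //=; first by left; exists (inl v).
    by move=> nb; right; congr (inl (inr _)); move: nb; rewrite (inj_eq inr_inj); case: b; case: nr.
  by left; exists (inr f).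
split.
- move=> x /nonroot[[p ->]|->]; last by rewrite /= eqxx.
  have [Oi ip] := in_edgeP p; rewrite matching_emb -{1}ip.
  by apply: half_inc; rewrite Oi.
- move=> x y /nonroot[[p ->]|->] /nonroot[[q ->]|->] //; rewrite ?matching_emb.
  + have [Op ip] := in_edgeP p; have [Oq iq] := in_edgeP q.
    by move/(half_inj Op Oq) => pq; rewrite -ip -iq pq.
  + by have [Op _] := in_edgeP p; move/(half_neq Op).
  by have [Oq _] := in_edgeP q; move/esym/(half_neq Oq).
have from y : O y = false -> exists2 x, ~~ root x & (temperley_matching x).1 = (half y).1.
  by move=> Oy; exists (emb (white_end y)); rewrite ?root_emb ?matching_emb ?in_edgeE.
case=> [[e|i]|[]].
- have [y [Oy ye]] := out_edge_ex e; have [x nx xe] := from y Oy; exists x => //.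
  by rewrite xe; case: y ye {Oy xe} => [[[e' b]|i] s] //= [->].
- have Oi : O (inr i, true) = false by rewrite O_boundary.
  by have [x nx xe] := from _ Oi; exists x.
- by exists (inl (inr nr)) => //=; rewrite (inj_eq inr_inj); case: nr.
have Oi : O (inr i0, false) = false by rewrite O_boundary eqxx.
by have [x nx xe] := from _ Oi; exists x => //; rewrite xe /= eqxx.
Qed.

Definition half_walk C : seq (W * (E * bool)) :=
  [seq (emb (white_end y), half y) | y <- C & O y].

Local Notation mrel := (fun p q : W * (E * bool) => p.2.1 == (temperley_matching q.1).1).
Local Notation msign := (fun p : W * (E * bool) =>
  - ((bsign p.2.2 : int) * bsign (temperley_matching p.1).2)).

(** The signs are integers, so the identity proved over the real closed field [realalg] descends
    along the injection of the integers. *)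
Lemma kasteleyn_cycle_int ps :
  ps != [::] -> uniq [seq p.1 | p <- ps] ->
  (forall p, p \in ps -> ~~ root p.1 && inc p.1 p.2) ->
  cycle mrel ps -> \prod_(p <- ps) msign p = -1.
Proof.
move=> ps0 Ups incps cps.
have [plV plF] := sphere_planar planarG j i0E (realalg : realFieldType) (~~ nr).
have := kasteleyn_cycle plV plF temperley_full_matching ps0 Ups incps cps.
move=> E0; apply: (@intr_inj (realalg : numDomainType)).
rewrite rmorph_prod /= [RHS]rmorphN1 -[RHS]E0; apply: eq_bigr => p _.
by rewrite rmorphN rmorphM /=; congr (- (_ * _)); rewrite /bsign; case: ifP.
Qed.

(** Colours alternate, so the induction consumes two edges at a time: one leaving a white vertex,
    then the matched edge entering the next one. The factor of a white vertex in [msign] involves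
    the edge entering it, which shifts the product by one edge; the factors of [y0] and of the last
    edge correct this. *)
Lemma half_walk_path y0 C (p0 : W * (E * bool)) :
  O y0 = false -> path (fun y y' => head y == tail y') y0 C ->
  O (last y0 C) = false -> p0.2.1 = (half y0).1 ->
  [/\ path mrel p0 (half_walk C),
      (last p0 (half_walk C)).2.1 = (half (last y0 C)).1
    & (\prod_(p <- half_walk C) msign p) * bsign (half_side (last y0 C)) =
      (\prod_(y <- C) edge_sign y) * bsign (half_side y0)].
Proof.
move: {-1}(size C) (leqnn (size C)) => k.
elim: k C y0 p0 => [|k IHk] [|a [|b s]] y0 p0 //=.
- by move=> _ Oy0 _ _ p0E; rewrite /half_walk /= !big_nil.
- by move=> _ Oy0 _ _ p0E; rewrite /half_walk /= !big_nil.
- by move=> _ Oy0 /andP[/eqP/walk_step[-> _] _]; rewrite Oy0.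
rewrite !ltnS => sz Oy0 /and3P[/eqP/walk_step[Oa]] ; rewrite Oy0 in Oa *.
move=> wa /eqP/walk_step[Ob]; rewrite Oa in Ob *; case=> e [ae be] pb Ol p0E.
have ab : (half a).1 = (half b).1.
  by case: a ae {wa Oa} => [[[? ?]|?] ?] //= [->]; case: b be {Ob pb Ol} => [[[? ?]|?] ?] //= [->].
have [|IH1 IH2 IH3] := IHk s b (emb (white_end a), half a) (ltnW sz) Ob pb Ol; first by [].
rewrite wa in IH1 IH2.
rewrite /half_walk /= Oa Ob /= -/(half_walk s) wa IH1 matching_emb in_edgeE // p0E eqxx.
split=> //; rewrite !big_cons /= -mulrA IH3 /edge_sign Oa Ob /= matching_emb in_edgeE //.
have hs y : (half y).2 = half_side y by case: y.
by rewrite !hs /(bsign true) /(bsign false); ring.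
Qed.

Lemma half_walk_uniq C : uniq [seq tail y | y <- C] -> uniq [seq p.1 | p <- half_walk C].
Proof.
rewrite /half_walk -map_comp => /(subseq_uniq (map_subseq _ (filter_subseq O C))).
have -> : [seq tail y | y <- C & O y] = [seq inr (white_end y) | y <- C & O y].
  by apply/eq_in_map => y; rewrite mem_filter tailE => /andP[-> _].
rewrite (map_comp inr) (map_inj_uniq inr_inj) (map_comp emb) => U.
by rewrite (map_inj_uniq emb_inj).
Qed.

Lemma half_walk_inc C p : p \in half_walk C ->
  (forall y, y \in C -> O y -> forall i, y = (inr i, false) -> i = j) ->
  ~~ root p.1 && inc p.1 p.2.
Proof.
case/mapP=> y; rewrite mem_filter => /andP[Oy yC] -> /(_ y yC) H /=.
by rewrite root_emb half_inc.
Qed.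

End Closure.

Local Notation step := (fun y y' : edge T => head y == tail y').

Lemma step_inner y y' : head y = tail y' -> O y -> forall i, y <> (inr i, false).
Proof. by case/walk_step=> _; case: (O y) => // -[e [ye _]] _ i yi; rewrite yi in ye. Qed.

Lemma temperley_cycle_sign C : C != [::] -> cycle step C ->
  uniq [seq tail y | y <- C] -> \prod_(y <- C) edge_sign y = -1.
Proof.
(* A rotation of the cycle makes its last edge enter a white vertex, as [half_walk_path] requires of
   both extremities. *)
wlog: C / O (last (inr i0, true) C) = false => [main C0 cC UC|OC C0 cC UC].
  case OC: (O (last (inr i0, true) C)); last exact: main.
  case: C C0 cC UC OC => // y C _ cC UC OC.
  have := cC; rewrite (cycle_path y) => /andP[/eqP/walk_step[Oy _] _].
  rewrite -[LHS](perm_big _ (permEl (perm_rot 1 (y :: C)))).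
  apply: main => //; last by rewrite map_rot rot_uniq.
  - by rewrite rot1_cons last_rcons; move: Oy => /=; rewrite /= in OC *; rewrite OC.
  - by rewrite rot1_cons; case: (C).
  by rewrite rot_cycle.
pose y0 := last (inr i0, true) C.
pose ps := half_walk C.
have pC : path step y0 C by rewrite -(cycle_path (inr i0, true)).
have lC : last y0 C = y0 by rewrite /y0; case: (C) C0.
have noout y : y \in C -> O y -> forall i, y = (inr i, false) -> i = i0.
  move=> yC Oy i yi; case: (@step_inner y (next C y) _ Oy i yi).
  by apply/eqP; apply: (next_cycle cC).
(* A starting point for [path], of which only the edge is compared with what follows. *)
pose d : (sphere_vert G + sphere_face G) * (sphere_edge G * bool) :=
  (inl (inr true), half y0).
have [] := half_walk_path true OC pC _ (erefl : d.2.1 = _); first by rewrite lC.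
rewrite lC -/ps => pd ld prodE.
have ps0 : ps != [::].
  have : y0 \in C by rewrite /y0; case: (C) C0 => //= y C' _; apply: mem_last.
  move=> y0C; have prevC : prev C y0 \in C by rewrite mem_prev.
  have /walk_step[] : head (prev C y0) = tail y0 by apply/eqP; apply: (prev_cycle cC).
  rewrite OC => /esym/negbFE Op _.
  have : (emb (white_end (prev C y0)), half (prev C y0)) \in ps.
    by apply: map_f; rewrite mem_filter Op.
  by case: (ps).
have cyc : cycle (fun p q => p.2.1 == (temperley_matching true q.1).1) ps.
  rewrite (cycle_path d); case: (ps) ps0 pd ld => //= p s _ /andP[dp ->] ->.
  by rewrite andbT.
have := kasteleyn_cycle_int (j := i0) ps0 (half_walk_uniq UC) _ cyc.
have side0 : bsign (half_side y0) != 0 :> int by rewrite /bsign; case: ifP.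
move=> <-; first by apply: (mulIf side0).
by move=> p /half_walk_inc; apply.
Qed.

(** The product of the signs of the two half-edges that close a path on the sphere; it is -1 when
    the path starts at a leg of the star [inr true]. *)
Definition path_sign (c : 'I_(n.*2)) (j : 'I_n) : int :=
  if ~~ odd c && (0 < c./2 <= j)%N then -1 else 1.

Lemma dwalk_path u v y C :
  dwalk O u v (y :: C) = [&& tail y == u, path step y C & head (last y C) == v].
Proof.
elim: C u y => [|y' C IHC] u y //.
rewrite [LHS]/= -/(dwalk O (head y) v (y' :: C)) IHC.
by rewrite [path _ _ _]/= -andbA [tail y' == _]eq_sym.
Qed.

(** On the sphere the sink becomes the edge [inr true], matched with the star [inr nr], and that
    star is also an end of the edge where the path starts. One more white vertex thus closes the
    path into an alternating cycle. *)
Lemma temperley_path_sign c j C : j != i0 -> c \in sources O ->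
  dwalk O (bdv T c) (bdv T (double_ord j true)) C ->
  uniq [seq tail y | y <- C] -> \prod_(y <- C) edge_sign y = path_sign c j.
Proof.
move=> nj; rewrite O_sources inE => cO.
have nj0 : j != 0%N :> nat by apply: contraNneq nj => j0; apply/eqP/ord_inj; rewrite j0 i0E.
case: C => [|y0 C].
  by rewrite /= => /eqP[] cE; move: cO; rewrite cE /=; lia.
rewrite dwalk_path => /and3P[/eqP + pC /eqP].
rewrite tailE; case: ifP => // Oy0 /black_boundary[k [t [y0E cE]]].
case/lastP: C pC => [|C yl]; first by rewrite headE Oy0.
rewrite last_rcons rcons_path (headE yl) => /andP[pC /eqP stepl].
case: ifP => // Oyl /black_boundary[j' [t' [ylE /double_ord_inj[jj' t'E]]]].
case: t' t'E ylE => // _; rewrite -{j'}jj' => ylE.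
have [] := walk_step stepl; rewrite Oyl => /esym/negbTE Olast; rewrite Olast => wl.
(* The star that is not a root must be the one carrying the leg of the source; a path from label 2
   starts at the edge [inr false], which meets both stars. *)
move=> UC; pose nr := star j k.
pose q : sphere_edge G * bool := if t then (inl (inr k), false) else (inr false, nr).
have tk : ~~ t -> k = i0.
  by move=> nt; move: Oy0; rewrite y0E O_boundary nt => /negbFE/eqP.
have qE : q.1 = (half y0).1.
  by rewrite /q y0E; case: (t) tk => //= /(_ isT) ->; rewrite eqxx.
pose ps := (inl (inr nr) : sphere_vert G + sphere_face G, q).
have [pps lps prodE] := half_walk_path nr Oy0 pC Olast (qE : ps.2.1 = _).
pose hw := half_walk (rcons C yl).
have hwE : hw = rcons (half_walk C) (emb (white_end yl), half yl).
  by rewrite /hw /half_walk filter_rcons Oyl map_rcons.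
have inl_yl : temperley_matching nr (emb (white_end yl)) = half (last y0 C).
  by rewrite matching_emb wl in_edgeE.
have cyc : cycle (fun p q => p.2.1 == (temperley_matching nr q.1).1) (rcons hw ps).
  rewrite (cycle_path ps) last_rcons rcons_path hwE last_rcons rcons_path pps /=.
  by rewrite inl_yl lps eqxx ylE /= nj.
have UC' : uniq [seq tail y | y <- rcons C yl].
  by move: UC; rewrite /= => /andP[].
have uhw : uniq [seq p.1 | p <- rcons hw ps].
  rewrite map_rcons rcons_uniq half_walk_uniq // andbT.
  by apply/mapP=> -[p /mapP[y _ ->]] /=; case: (white_end y).
have inchw p : p \in rcons hw ps ->
    ~~ is_root (inr (~~ nr) : sphere_vert G) (None : sphere_face G) p.1 &&
    incident (@vend n G j) (@fend n G i0 j) p.1 p.2.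
  rewrite mem_rcons inE => /predU1P[->|/half_walk_inc]; last first.
    apply=> y yC Oy i yi.
    have : path step y0 (rcons C yl) by rewrite rcons_path pC stepl eqxx.
    have : last y0 (rcons C yl) = yl by rewrite last_rcons.
    case/splitPr: yC => C1 [|y' C2].
      by rewrite last_cat /= yi ylE => -[].
    rewrite cat_path /= => _ /and3P[_ _ /andP[/eqP yy' _]].
    by case: (step_inner yy' Oy yi).
  rewrite /= /q; have -> : ((inr nr : sphere_vert G) != inr (~~ nr)) by case: (nr).
  by case: (t) => /=.
have := kasteleyn_cycle_int _ uhw inchw cyc.
rewrite -cats1 big_cat big_seq1 /= hwE -cats1 big_cat big_seq1 /= inl_yl => KC.
have hs y : (half y).2 = half_side y by case: y.
rewrite !hs in KC.
rewrite big_cons -cats1 big_cat big_seq1 /= /edge_sign Oy0 Oyl.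
have : path_sign c j = bsign q.2 * bsign nr.
  rewrite /path_sign cE /q /nr /star; case: (t) => /=.
    by rewrite odd_double doubleK /=; case: ifP.
  by rewrite odd_double /= bsignK.
move=> ->.
set P := \prod_(p <- half_walk C) _ in prodE KC.
set Q := \prod_(y <- C) _ in prodE *.
have {}KC : Q * bsign (half_side y0) * bsign (half_side yl) * (bsign q.2 * bsign nr) = -1.
  by rewrite -prodE -KC; [ring|case: (half_walk C)].
have UU : (bsign q.2 * bsign nr) * (bsign q.2 * bsign nr) = 1 :> int.
  by rewrite mulrACA !bsignK.
move: KC UU; set U := _ * bsign nr => KC UU.
have -> : U = - (-1 * U) by rewrite mulN1r opprK.
by rewrite -KC -[_ * U * U]mulrA UU /(bsign true) /(bsign false); ring.
Qed.

End Orientation.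

(** * Parity of the winding index *)

Section Winding.
Variables (n : nat) (G : diskmap n).
Hypothesis planarG : planar_disk G.
Variables (i0 : 'I_n) (i0E : i0 = 0%N :> nat).
Variable O : edge (temperley G) -> bool.
Hypothesis O_perfect : perfect O (@nd_white n G).
Hypothesis O_sources : sources O = O2_sources n.
Variable R : realFieldType.

Local Notation T := (temperley G).
Local Notation tail y := (dtail (odart O y)).
Local Notation head y := (dhead (odart O y)).
Local Notation step := (fun y y' : edge T => head y == tail y').
Implicit Types (y : edge T) (C s q : seq (edge T)).

Definition rsign y : R := (edge_sign i0 O y)%:~R.

Lemma rsign_cycle C : C != [::] -> cycle step C ->
  uniq [seq tail y | y <- C] -> \prod_(y <- C) rsign y = -1.
Proof.
move=> C0 cC UC; rewrite /rsign -rmorph_prod.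
by rewrite (temperley_cycle_sign planarG i0E O_perfect O_sources) // rmorphN1.
Qed.

Lemma path_sign_sqr c (j : 'I_n) : (path_sign c j)%:~R * (path_sign c j)%:~R = 1 :> R.
Proof. by rewrite -rmorphM /path_sign; case: ifP. Qed.

Lemma pos_self m (H : diskmap m) (d : dart H) : index d (fingraph.orbit (@rotd m H) d) = 0%N.
Proof. by rewrite /fingraph.orbit -orderSpred /= eqxx. Qed.

(* At a white vertex y1 and y3 are both its only incoming edge; at a black vertex
   y2 and y4 are both its only outgoing edge. *)
Lemma crossing_perfect y1 y2 y3 y4 :
  head y1 = tail y2 -> head y3 = tail y2 -> tail y4 = tail y2 ->
  crossing (odart O y1) (odart O y2) (odart O y3) (odart O y4) = 0.
Proof.
move=> h12 h32 t42; have [O12 w12] := walk_step h12; have [O32 w32] := walk_step h32.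
rewrite /crossing; case O2: (O y2) O12 O32.
  move=> /esym/negbTE O1 /esym/negbTE O3; rewrite O1 in w12; rewrite O3 in w32.
  have -> : y3 = y1.
    by rewrite -(in_edgeE O_perfect O3) -(in_edgeE O_perfect O1) -w12 -w32.
  by rewrite pos_self !ltn0 !andbF.
move=> /esym/negbFE O1 _; rewrite O1 in w12; case: w12 => e [_ be2].
have -> : y4 = y2; last by rewrite ltnNge [in X in if X then _ else _]ltn_neqAle; case: ltngtP => //=; rewrite ?andbF.
move: t42; rewrite !tailE O2; case O4: (O y4) => be4; first by case: (black_endP (esym be4)).
by apply: (out_edge_uniq O_perfect O4 O2 _ be2); rewrite be4.
Qed.

Lemma dwalk_cat u v s q :
  dwalk O u v (s ++ q) =
  dwalk O u (last u [seq head y | y <- s]) s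
  && dwalk O (last u [seq head y | y <- s]) v q.
Proof.
elim: s u => [|y s IHs] u /=; first by rewrite eqxx.
by rewrite -andbA; congr (_ && _); apply: IHs.
Qed.

Lemma dwalk_tails u v s : dwalk O u v s ->
  [seq tail y | y <- s] = belast u [seq head y | y <- s].
Proof.
elim: s u => [|y s IHs] u //= /andP[/eqP yu ys].
by congr (_ :: _); [exact: yu|exact: IHs].
Qed.

(** Erasing a loop changes the index by an odd number and removes a factor -1 from the product, so
    both sides change alike. At the end the index is 0 and the product along the remaining simple
    path is [path_sign], whose square is 1. *)
Lemma wind_from_sign c (j : 'I_n) s q : j != i0 -> c \in sources O ->
  dwalk O (bdv T c) (bdv T (double_ord j true)) (s ++ q) ->
  uniq (bdv T c :: [seq head y | y <- s]) ->
  (-1) ^ wind_from [seq odart O y | y <- s] [seq odart O y | y <- q] =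
  (path_sign c j)%:~R * \prod_(y <- s ++ q) rsign y :> R.
Proof.
move=> nj cO; set u := bdv T c; elim: q s => [|d q IHq] s ws Us.
  rewrite cats0 in ws *.
  have Ut : uniq [seq tail y | y <- s].
    by rewrite (dwalk_tails ws); move: Us; rewrite lastI rcons_uniq => /andP[].
  rewrite /rsign -rmorph_prod /=.
  rewrite (temperley_path_sign planarG i0E O_perfect O_sources nj cO ws Ut).
  by rewrite path_sign_sqr.
rewrite -cat_rcons in ws *; rewrite [LHS]/= -/(odart O d) -map_rcons.
set s' := rcons s d in ws *.
have /andP[ws' wq] : dwalk O u (last u [seq head y | y <- s']) s'
    && dwalk O (last u [seq head y | y <- s']) (bdv T (double_ord j true)) q.
  by rewrite -dwalk_cat.
have ls' : last u [seq head y | y <- s'] = head d by rewrite map_rcons last_rcons.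
have ts' : [seq tail y | y <- s'] = u :: [seq head y | y <- s].
  by rewrite (dwalk_tails ws') map_rcons belast_rcons.
rewrite find_map size_map; set k := find _ s'.
have -> : (k < size s')%N = (head d \in u :: [seq head y | y <- s]).
  rewrite -has_find -ts' -has_pred1 has_map; exact: eq_has.
case: ifPn => [hd|nhd]; last first.
  apply: IHq => //.
  by rewrite map_rcons -rcons_cons rcons_uniq nhd.
have kE : (k < size s')%N.
  rewrite -has_find; move: hd; rewrite -ts' => /mapP[y ys' yd].
  by apply/hasP; exists y => //; rewrite /= yd.
pose yk := nth d s' k.
have tyk : tail yk = head d.
  apply/eqP; apply: (nth_find d (_ : has (fun y => tail y == head d) s')).
  by rewrite has_find.
have dE : drop k s' = yk :: drop k.+1 s' by rewrite (drop_nth d).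
set C := drop k s'.
have s'E : s' = take k s' ++ C by rewrite cat_take_drop.
have /andP[wt wC] : dwalk O u (last u [seq head y | y <- take k s']) (take k s')
    && dwalk O (last u [seq head y | y <- take k s']) (head d) C.
  by rewrite -dwalk_cat -s'E -ls'.
have lt : last u [seq head y | y <- take k s'] = head d.
  by move: wC; rewrite /C dE /= => /andP[/eqP <- _].
have Cprod : \prod_(y <- C) rsign y = -1.
  apply: rsign_cycle; first by rewrite /C dE.
    move: wC; rewrite /C dE dwalk_path => /and3P[_ pC /eqP lC].
    rewrite (cycle_path d); apply/andP; split; last exact: pC.
    by apply/eqP; rewrite [LHS]lC tyk.
  by rewrite /C map_drop drop_uniq // ts'.
have eps0 : match rev (take k [seq odart O y | y <- s']), [seq odart O y | y <- q] with
    | e1 :: _, e4 :: _ =>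
        crossing e1 (seq.head (odart O d) (drop k [seq odart O y | y <- s'])) (odart O d) e4
    | _, _ => 0 end = 0.
  rewrite -map_take -map_drop -map_rev dE /=.
  case/lastP E: (take k s') => [|t y1] //; rewrite rev_rcons.
  case: (q) wq => [|y4 q'] //=; rewrite ls' => /andP[/eqP t4 _].
  apply: crossing_perfect; rewrite ?tyk //.
  by rewrite -lt E map_rcons last_rcons.
rewrite [X in _ + X + _](_ : _ = 0) ?addr0; last exact: eps0.
rewrite expfzDr ?oppr_eq0 ?oner_neq0 // -map_take IHq; first last.
- rewrite map_take; have : uniq (take k.+1 (u :: [seq head y | y <- s])) by rewrite take_uniq.
  rewrite /= map_rcons -cats1 takel_cat // size_map.
  by move: kE; rewrite size_rcons ltnS.
- by rewrite dwalk_cat lt -ls' wq andbT ls' -lt.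
have ps' : \prod_(y <- s') rsign y = \prod_(y <- take k s') rsign y * -1.
  by rewrite [in LHS]s'E big_cat /= Cprod.
rewrite !big_cat /= ps'.
(* The turn is 1 or -1, so its parity is the same for both directions of the loop. *)
have -> : (-1 : R) ^ turn (drop k [seq odart O y | y <- s']) = -1.
  by rewrite /turn; case: ifP => _; rewrite ?expr1z ?exprN1 ?invrN1.
ring.
Qed.

Lemma wind_sign c (j : 'I_n) q : j != i0 -> c \in sources O ->
  dwalk O (bdv T c) (bdv T (double_ord j true)) q ->
  (-1) ^ wind [seq odart O y | y <- q] =
  (path_sign c j)%:~R * \prod_(y <- q) rsign y :> R.
Proof. by move=> nj cO wq; apply: (@wind_from_sign c j [::]). Qed.

End Winding.

(** * Boundary measurements as entries of an inverse matrix *)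

Section LowDegree.
Variables (R : idomainType) (N : nat).
Implicit Types (p q : {mpoly R[N]}) (k : nat).

Definition low0 k p : Prop := forall a, (mdeg a <= k)%N -> mcoeff a p = 0.

Lemma low0M k p q : low0 k q -> low0 k (p * q).
Proof.
move=> q0 a ak; rewrite mcoeffM big1 // => -[b c] /= /eqP/(congr1 (@mdeg N)).
rewrite mdegD => aE; rewrite q0 ?mulr0 //; apply: leq_trans ak.
by rewrite [X in (_ <= X)%N]aE leq_addl.
Qed.

Lemma low0_sum k (I : finType) (P : pred I) (F : I -> {mpoly R[N]}) :
  (forall i, P i -> low0 k (F i)) -> low0 k (\sum_(i | P i) F i).
Proof.
by move=> F0 a ak; rewrite (raddf_sum (mcoeff a)) big1 // => i Pi; apply: F0.
Qed.

Lemma low0_prodX k (I : Type) (s : seq I) (f : I -> 'I_N) : (k < size s)%N ->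
  low0 k (\prod_(i <- s) 'X_(f i)).
Proof.
move=> ks a ak.
have -> : \prod_(i <- s) 'X_(f i) = 'X_[\sum_(i <- s) U_(f i)] :> {mpoly R[N]}.
  by elim: (s) => [|i s' IHs]; rewrite ?big_nil ?mpolyX0 // !big_cons IHs mpolyXD.
rewrite mcoeffX; case: eqP => // E; move: ak; rewrite -E mdeg_sum.
by under eq_bigr => i _ do rewrite mdeg1; rewrite sum1_size leqNgt ks.
Qed.

Lemma low0_eq0 p : (forall k, low0 k p) -> p = 0.
Proof. by move=> p0; apply/mpolyP=> a; rewrite mcoeff0 (p0 (mdeg a)). Qed.

End LowDegree.

Section PathSums.
Variables (m : nat) (H : diskmap m) (O : edge H -> bool).
Local Notation tail y := (dtail (odart O y)).
Local Notation head y := (dhead (odart O y)).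

Definition walk_mx (K : comNzRingType) (x : edge H -> K) : 'M[K]_#|vert H| :=
  \matrix_(i, j)
    \sum_(y | (tail y == enum_val i) && (head y == enum_val j)) x y.

Section Sums.
Variables (K : comNzRingType) (x : edge H -> K).

Definition walk_sum (l : nat) : 'M[K]_#|vert H| :=
  \matrix_(i, j)
    \sum_(p : l.-tuple (edge H) | dwalk O (enum_val i) (enum_val j) p)
      \prod_(y <- p) x y.

Lemma walk_sum0 : walk_sum 0 = 1%:M.
Proof.
apply/matrixP=> i j; rewrite !mxE big_mkcond /=.
rewrite (big_pred1 [tuple]) => [|t]; last by apply/esym/eqP/val_inj; case: t => -[].
by rewrite big_nil /= (inj_eq enum_val_inj); case: eqP.
Qed.

Lemma walk_sumS l : walk_sum l.+1 = walk_mx x *m walk_sum l.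
Proof.
apply/matrixP=> i j; rewrite !mxE.
rewrite (reindex (fun q : edge H * l.-tuple (edge H) => [tuple of q.1 :: q.2])) /=; last first.
  exists (fun t => (thead t, [tuple of behead t])) => [[y t] _|t _] /=.
    by congr (_, _); apply: val_inj.
  by rewrite [t in RHS]tuple_eta; apply: val_inj.
rewrite (eq_bigr (fun q : edge H * l.-tuple (edge H) =>
           x q.1 * \prod_(y <- q.2) x y)) => [|q _]; last by rewrite big_cons.
rewrite -(pair_big_dep (fun y => tail y == enum_val i)
   (fun y (t : l.-tuple (edge H)) => dwalk O (head y) (enum_val j) t)
   (fun y (t : l.-tuple (edge H)) => x y * \prod_(z <- t) x z)) /=.
rewrite (partition_big (fun y => enum_rank (head y)) xpredT) //=.
apply: eq_bigr => k _; rewrite !mxE mulr_suml.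
rewrite (eq_bigl (fun y => (tail y == enum_val i) && (head y == enum_val k))).
  by apply: eq_bigr => y /andP[_ /eqP ->]; rewrite mulr_sumr.
by move=> y; rewrite -(inj_eq enum_val_inj) enum_rankK.
Qed.

Lemma walk_sum_geometric k :
  (1%:M - walk_mx x) *m (\sum_(l < k) walk_sum l) = 1%:M - walk_sum k.
Proof.
elim: k => [|k IHk]; first by rewrite big_ord0 mulmx0 walk_sum0 subrr.
rewrite big_ord_recr mulmxDr /= IHk mulmxBl mul1mx walk_sumS.
by rewrite addrA subrK.
Qed.

(** Cramer's rule for a truncated geometric series. With formal edge variables the remainder only
    has monomials of degree at least k. *)
Lemma walk_sum_det k i j :
  \det (1%:M - walk_mx x) * \sum_(l < k) walk_sum l i j =
  (\adj (1%:M - walk_mx x)) i j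
  - \sum_t (\adj (1%:M - walk_mx x)) i t * walk_sum k t j.
Proof.
have := congr1 (mulmx (\adj (1%:M - walk_mx x))) (walk_sum_geometric k).
rewrite mulmxA mul_adj_mx mul_scalar_mx mulmxBr mulmx1 => /matrixP/(_ i j).
by rewrite !mxE summxE.
Qed.

End Sums.

Variables (R : realFieldType) (w : edge H -> R).

(** If f / g and f' / g' both represent the series, f g' - f' g vanishes up to every degree k, as it
    is a combination of the defects of the two fractions at the truncation [B]. *)
Lemma bm_value_uniq i j z z' :
  bm_value O w i j z -> bm_value O w i j z' -> z = z'.
Proof.
case=> f [g [fg g0 ->]] [f' [g' [fg' g'0 ->]]].
apply/eqP; rewrite eqr_div // -!rmorphM /=; apply/eqP; congr meval.
apply/eqP; rewrite -subr_eq0; apply/eqP; apply: low0_eq0 => k.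
pose B := bm_trunc O R i j k.
have -> : f * g' - f' * g = g' * (f - g * B) + - g * (f' - g' * B) by ring.
move=> a ak; rewrite mcoeffD !(@low0M _ _ k) ?addr0 // => b bk.
  by rewrite mcoeffB fg' // subrr.
by rewrite mcoeffB fg // subrr.
Qed.

Variables (sg : edge H -> R) (i j : 'I_m) (sigma : R).
Hypothesis wind_sg : forall p, dwalk O (bdv H i) (bdv H j) p ->
  (-1) ^ wind [seq odart O y | y <- p] = sigma * \prod_(y <- p) sg y.
Hypothesis det_neq0 : \det (1%:M - walk_mx (fun y => sg y * w y)) != 0.

Lemma boundary_measurementE :
  boundary_measurement O w i j =
  sigma * invmx (1%:M - walk_mx (fun y => sg y * w y))
            (enum_rank (bdv H i)) (enum_rank (bdv H j)).
Proof.
set z := RHS.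
suff zP : bm_value O w i j z.
  apply: (@bm_value_uniq i j) => //.
  by apply: (@epsilon_spec R (inhabits 0) (bm_value O w i j)); exists z.
pose X (y : edge H) : {mpoly R[#|edge H|]} := sg y *: 'X_(enum_rank y).
pose ev : {rmorphism {mpoly R[#|edge H|]} -> R} := meval (fun r => w (enum_val r)).
have evA : map_mx ev (1%:M - walk_mx X) = 1%:M - walk_mx (fun y => sg y * w y).
  rewrite map_mxB map_mx1; congr (_ - _); apply/matrixP=> a b.
  rewrite !mxE; etransitivity; [exact: (rmorph_sum ev)|apply: eq_bigr => y _].
  by rewrite /ev /X /= mevalZ mevalXU enum_rankK.
(* The rational expression is [sigma] times an adjugate entry over the determinant, both taken with
   formal edge variables. *)
exists (sigma *: (\adj (1%:M - walk_mx X)) (enum_rank (bdv H i)) (enum_rank (bdv H j))).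
exists (\det (1%:M - walk_mx X)).
have truncE k : bm_trunc O R i j k = sigma *: \sum_(l < k.+1)
    walk_sum X l (enum_rank (bdv H i)) (enum_rank (bdv H j)).
  rewrite /bm_trunc scaler_sumr; apply: eq_bigr => l _.
  rewrite mxE !enum_rankK scaler_sumr; apply: eq_bigr => p wp.
  rewrite wind_sg // -scalerA; congr (_ *: _).
  rewrite /X; elim: (tval p) => [|y s IHs]; first by rewrite !big_nil scale1r.
  by rewrite !big_cons -IHs -scalerAl -scalerAr scalerA.
split.
- move=> k a ak; rewrite truncE -scalerAr walk_sum_det.
  rewrite scalerBr mcoeffB [X in _ - X](_ : _ = 0) ?subr0 //.
  rewrite mcoeffZ (@low0_sum _ _ k) ?mulr0 // => t _; apply: low0M.
  rewrite mxE; apply: low0_sum => p _ b bk.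
  rewrite (_ : \prod_(y <- p) X y = (\prod_(y <- p) sg y) *: \prod_(y <- p) 'X_(enum_rank y)).
    by rewrite mcoeffZ (@low0_prodX _ _ k) ?size_tuple ?mulr0 // size_tuple.
  rewrite /X; elim: (tval p) => [|y s IHs]; first by rewrite !big_nil scale1r.
  by rewrite !big_cons IHs -scalerAl -scalerAr scalerA.
- by rewrite -/(ev _) -det_map_mx evA.
rewrite /z -!/(ev _) mevalZ -/(ev _) -det_map_mx evA -mulrA; congr (_ * _).
rewrite /invmx unitmxE unitfE det_neq0 mxE -evA -map_mx_adj mxE mulrC //.
Qed.

End PathSums.

(** * Conjugate harmonic functions *)

Lemma card_ord_lt n b : (b <= n)%N -> #|[set i : 'I_n | (i < b)%N]| = b.
Proof.
move=> bn; have winj : injective (widen_ord bn) by move=> i i' /(congr1 val) ii'; apply: ord_inj.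
rewrite -[RHS]card_ord -(card_imset predT winj).
apply: eq_card => i; rewrite inE; apply/idP/imsetP => [ib|[i' _ ->]]; last exact: (ltn_ord i').
by exists (Ordinal ib) => //; apply: ord_inj.
Qed.

Lemma card_evens n a b : (a <= b <= n)%N ->
  #|[set k : 'I_(n.*2) | ~~ odd k && (a.*2 <= k < b.*2)%N]| = (b - a)%N.
Proof.
case/andP=> ab bn.
have dinj : injective (fun i : 'I_n => double_ord i false) by move=> i i' /double_ord_inj[].
have -> : [set k : 'I_(n.*2) | ~~ odd k && (a.*2 <= k < b.*2)%N] =
    [set double_ord i false | i in [set i : 'I_n | (i < b)%N] :\: [set i : 'I_n | (i < a)%N]].
  apply/setP=> k; rewrite inE; apply/idP/imsetP => [kab|[i + ->]]; last first.
    by rewrite !inE /= odd_double; lia.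
  exists (half_ord k); first by rewrite !inE /=; lia.
  by apply: ord_inj => /=; lia.
rewrite card_imset // cardsD (setIidPr _) ?card_ord_lt ?(leq_trans ab) //.
by apply/subsetP=> i; rewrite !inE => ia; apply: leq_trans ab.
Qed.

Section Final.
Variables (R : realFieldType) (n : nat) (G : diskmap n).
Hypothesis planarG : planar_disk G.
Variables (i0 : 'I_n) (i0E : i0 = 0%N :> nat).
Variable O : edge (temperley G) -> bool.
Hypothesis O_perfect : perfect O (@nd_white n G).
Hypothesis O_sources : sources O = O2_sources n.
Variables (w : edge G -> R) (w_gt0 : forall e, 0 < w e).

Local Notation T := (temperley G).
Local Notation tail y := (dtail (odart O y)).
Local Notation head y := (dhead (odart O y)).
Local Notation bd c := (bdv T c).
Local Notation sg := (rsign i0 O R).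
Local Notation wt := (pn_weight w O).
Local Notation B := (1%:M - walk_mx O (fun y => sg y * wt y)).
Implicit Types (y : edge T) (v : vert T) (u : vert T -> R).

Lemma sum_walk_mx u v :
  \sum_i u (enum_val i) * B i (enum_rank v) =
  u v - \sum_(y | head y == v) u (tail y) * (sg y * wt y).
Proof.
under eq_bigr => i _ do rewrite !mxE mulrBr.
rewrite sumrB; congr (_ - _).
  rewrite (bigD1 (enum_rank v)) //= enum_rankK eqxx mulr1 big1 ?addr0 // => i ne.
  by rewrite (negPf ne) mulr0.
rewrite (partition_big (fun y => enum_rank (tail y)) xpredT) //=.
apply: eq_bigr => i _; rewrite enum_rankK mulr_sumr.
rewrite [RHS](eq_bigl (fun y => (tail y == enum_val i) && (head y == v))).
  by apply: eq_bigr => y /andP[/eqP -> _].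
by move=> y; rewrite andbC -(inj_eq enum_val_inj) enum_rankK.
Qed.

(* u is a row of the resolvent of the signed walk matrix, or a vector of its
   left kernel (c0 = 0). *)
Section Potential.
Variables (u c0 : vert T -> R).
Hypothesis uE : forall v, u v - \sum_(y | head y == v) u (tail y) * (sg y * wt y) = c0 v.
Hypothesis c0_int : forall v, interior v -> c0 v = 0.
Hypothesis c0_sink : forall c, c \notin sources O -> c0 (bd c) = 0.

(** With this minus sign, and its analogue in [fpot], the boundary values of the potentials are
    those of [u] at the boundary labels ([vpot_bd], [fpot_bd]). *)
Definition vpot (t : vert G) : R := - u (inr (inl t)).
Definition fpot (f : disk_face G) : R := - u (inr (inr f)).

Lemma sgE y : sg y = bsign (O y) * bsign (half_side i0 y).
Proof.
rewrite /rsign /edge_sign rmorphM /=; congr (_ * _); rewrite /bsign; by case: ifP.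
Qed.

Lemma wtE y : wt y = if O y then nd_weight w y else (nd_weight w y)^-1.
Proof.
rewrite /pn_weight tailE; case: (O y) => //.
by case E: (nd_black_end y) => [//|p]; case: (@black_endP _ _ y p).
Qed.

Lemma nd_weight_gt0 y : 0 < nd_weight w y.
Proof. by case: y => [[[e b]|i] [|]] /=; rewrite ?ltr01. Qed.

Lemma u_white y : O y = false ->
  bsign (half_side i0 y) * nd_weight w y * u (inr (white_end y)) = - u (nd_black_end y).
Proof.
move=> Oy; have := uE (inr (white_end y)); rewrite c0_int; last exact: white_interior.
rewrite (big_pred1 y) => [|z].
  rewrite tailE Oy sgE wtE Oy => /eqP; rewrite subr_eq0 => /eqP ->.
  have := nd_weight_gt0 y; have := bsignK R (half_side i0 y).
  move=> bb w0; rewrite [bsign false]/bsign.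
  rewrite [LHS](_ : _ = - (bsign (half_side i0 y) * bsign (half_side i0 y))
     * (nd_weight w y / nd_weight w y) * u (nd_black_end y)); last by ring.
  by rewrite bb divff ?gt_eqF // mulr1 mulN1r.
rewrite headE /=; case Oz: (O z).
  have -> : (z == y) = false by apply/eqP=> zy; rewrite zy Oy in Oz.
  by apply/eqP=> /black_endP.
apply/eqP/eqP => [[zw]|->//].
by rewrite -(in_edgeE O_perfect Oz) zw (in_edgeE O_perfect Oy).
Qed.

Lemma u_black v : (forall c, v <> inr c) ->
  u v = c0 v + \sum_(y | O y && (nd_black_end y == v))
                 bsign (half_side i0 y) * nd_weight w y * u (inr (white_end y)).
Proof.
move=> vb; rewrite -[u v in LHS](subrK (\sum_(y | head y == v) u (tail y) * (sg y * wt y))).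
rewrite uE; congr (_ + _); apply: eq_big => y; rewrite ?headE ?tailE.
  by case: (O y) => //=; apply/eqP=> /esym/vb.
case Oy: (O y) => yv; last by case: (vb _ (esym (eqP yv))).
by rewrite sgE wtE Oy [bsign true]/bsign; ring.
Qed.

(** By [u_black] the edges entering w_e contribute u (w_e), and by [u_white] the edge leaving it
    contributes - u (w_e). The sum over all four half-edges is thus zero, in a form where the
    orientation has disappeared. *)
Lemma cauchy_riemann e :
  w e * (vpot (endpt e true) - vpot (endpt e false))
  + (fpot (face_of (inl (e, true))) - fpot (face_of (inl (e, false)))) = 0.
Proof.
pose F y := bsign (half_side i0 y) * nd_weight w y * u (inr (white_end y)).
have s0 : \sum_(y | nd_black_end y == inl (inr e)) F y = 0.
  rewrite (bigID O) /=.
  have -> : \sum_(y | (nd_black_end y == inl (inr e)) && O y) F y = u (inl (inr e)).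
    rewrite u_black // c0_int ?add0r; last by apply/codomP => -[c].
    by apply: eq_bigl => y; rewrite andbC.
  have [y0 [Oy0 y0e]] := out_edge_ex O_perfect e.
  rewrite (big_pred1 y0) => [|y]; first by rewrite /F u_white // y0e subrr.
  apply/andP/eqP => [[/eqP ye /negbTE Oy]|->]; last by rewrite y0e Oy0.
  exact: (out_edge_uniq O_perfect Oy Oy0 ye y0e).
move: s0; rewrite big_mkcond /=.
have -> : \sum_(y : edge T) (if nd_black_end y == inl (inr e) then F y else 0) =
   \sum_(b : bool) \sum_(s : bool) F (inl (e, b), s).
  transitivity (\sum_(x : hedge G) \sum_(s : bool)
      if nd_black_end ((x, s) : edge T) == inl (inr e) then F (x, s) else 0).
    by rewrite pair_bigA; apply: eq_bigr => -[x s].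
  rewrite big_sumType /= [X in _ + X]big1 ?addr0; last by move=> i _; rewrite big1.
  transitivity (\sum_(e' : edge G) \sum_(b : bool) \sum_(s : bool)
      if (inl (inr e') : nd_vert G) == inl (inr e) then F (inl (e', b), s) else 0).
    by rewrite [RHS]pair_bigA; apply: eq_bigr => -[e' b].
  rewrite (bigD1 e) //= [X in _ + X]big1 ?addr0.
    by apply: eq_bigr => b _; apply: eq_bigr => s _; rewrite eqxx.
  move=> e' ne; rewrite big1 // => b _; rewrite big1 // => s _.
  by case: eqP => // -[ee]; rewrite ee eqxx in ne.
rewrite !big_bool /F /= /vpot /fpot /bsign => E0.
by rewrite -[RHS]oppr0 -E0; ring.
Qed.

Lemma u_source i s : ~~ O (inr i, s) -> u (bd (double_ord i (~~ s))) = c0 (bd (double_ord i (~~ s))).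
Proof.
move=> Oi; rewrite u_black // big1 ?addr0 // => y /andP[Oy /eqP yb].
have yE : y = (inr i, s) by apply: (boundary_edge_uniq yb).
by rewrite -yE Oy in Oi.
Qed.

Lemma vpot_bd i : vpot (bdv G i) = u (bd (double_ord i false)).
Proof.
have Oi : O (inr i, true) = false by rewrite (O_boundary i0E O_sources).
by have := u_white Oi; rewrite /= /bsign !mul1r => ui; rewrite /vpot -[RHS]opprK -ui.
Qed.

Lemma fpot_bd i : fpot (face_of (inr i)) = u (bd (double_ord i true)).
Proof.
case: (eqVneq i i0) => [->|ni].
  have Oi : O (inr i0, false) = false by rewrite (O_boundary i0E O_sources) eqxx.
  have := u_white Oi; rewrite /= eqxx /bsign !mul1r => ui.
  by rewrite /fpot -[RHS]opprK -ui.
have Oi : O (inr i, false) by rewrite (O_boundary i0E O_sources).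
rewrite u_black // c0_sink ?add0r.
  rewrite (big_pred1 (inr i, false)) => [|y].
    by rewrite /= (negPf ni) /bsign mulr1 mulN1r.
  apply/andP/eqP => [[Oy /eqP yb]|->]; last by rewrite Oi.
  exact: (boundary_edge_uniq yb).
rewrite O_sources inE /=; have : i != 0%N :> nat.
  by apply: contraNneq ni => ie; apply/eqP/ord_inj; rewrite ie i0E.
by lia.
Qed.

Lemma half_cauchy_riemann e b :
  w e * (vpot (endpt e b) - vpot (endpt e (~~ b))) =
  - (fpot (face_of (inl (e, b))) - fpot (face_of (inl (e, ~~ b)))).
Proof.
have /eqP := cauchy_riemann e; rewrite addr_eq0 => /eqP E0.
case: b => //=; rewrite -[_ - vpot (endpt e true)]opprB mulrN E0; ring.
Qed.

Lemma current_vpot (v : vert G) : current w vpot v =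
  \sum_(i | bdv G i == v)
     (fpot (face_of (inr (ord_pred i))) - fpot (face_of (inr i))).
Proof.
have /eqP := face_divergence planarG fpot v; rewrite addrC addr_eq0 => /eqP ->.
rewrite -sumrN; apply: eq_bigr => -[e b] /= /eqP <-.
exact: half_cauchy_riemann.
Qed.

End Potential.

Lemma bdv_pred1 (i : 'I_n) (a : 'I_n -> R) : \sum_(k | bdv G k == bdv G i) a k = a i.
Proof.
have [bd_inj _ _ _ _] := planarG.
by rewrite (big_pred1 i) // => k; rewrite (inj_eq bd_inj).
Qed.

(* The energy of the potential is zero, as h vanishes at the boundary. *)
Lemma resolvent_kernel u :
  (forall v, u v - \sum_(y | head y == v) u (tail y) * (sg y * wt y) = 0) ->
  forall v, u v = 0.
Proof.
move=> uE; pose c0 (v : vert T) : R := 0.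
have c0i v : interior v -> c0 v = 0 by [].
have c0s c : c \notin sources O -> c0 (bd c) = 0 by [].
have src i s : ~~ O (inr i, s) -> u (bd (double_ord i (~~ s))) = 0.
  exact: (u_source (c0 := c0) uE).
have h0 i : vpot u (bdv G i) = 0.
  by rewrite (vpot_bd uE) // (src i true) // (O_boundary i0E O_sources).
have g0 : fpot u (face_of (inr i0)) = 0.
  by rewrite (fpot_bd uE) // (src i0 false) // (O_boundary i0E O_sources) eqxx.
(* As h vanishes at the boundary, its extension by 0 does not vary along the legs and the extra
   edges, so [sphere_orth] only retains the edges of the network. *)
pose hh (p : sphere_vert G) := match p with inl t => vpot u t | inr _ => 0 end.
pose gg (p : sphere_face G) := match p with Some f => fpot u f | None => 0 end.
have cr e : w e * cobd (@vend n G i0) hh (inl (inl e))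
    = - cobd (@fend n G i0 i0) gg (inl (inl e)).
  exact: (half_cauchy_riemann uE c0i e true).
have leg0 (x : 'I_n) : cobd (@vend n G i0) hh (inl (inr x)) = 0.
  by rewrite /cobd /= h0 subrr.
have ext0 (x : bool) : cobd (@vend n G i0) hh (inr x) = 0 by rewrite /cobd /= subrr.
have Dh e : cobd (@vend n G i0) hh (inl (inl e)) = 0.
  have := sphere_orth planarG i0 i0E hh gg.
  rewrite big_sumType /= [X in _ + X]big1 ?addr0 => [|x _]; last by rewrite ext0 mul0r.
  rewrite big_sumType /= [X in _ + X]big1 ?addr0 => [|x _]; last by rewrite leg0 mul0r.
  move/(congr1 (@GRing.opp R)); rewrite oppr0 -sumrN => s0.
  have pos e' : true -> 0 <= - (cobd (@vend n G i0) hh (inl (inl e'))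
                   * cobd (@fend n G i0 i0) gg (inl (inl e'))).
    move=> _; rewrite -mulrN -cr mulrCA; apply: mulr_ge0; first exact: ltW.
    by rewrite -expr2 sqr_ge0.
  have /(_ e isT)/eqP := psumr_eq0P pos s0.
  rewrite -mulrN -cr mulrCA mulf_eq0 gt_eqF //= mulf_eq0 orbb.
  by move/eqP.
have hz t : vpot u t = 0.
  apply: (sphere_vert_connected planarG i0 (j := i0) (h := hh) true _ (inl t)).
  by case=> [[e|x]|x].
have gleg i : fpot u (face_of (inr (ord_pred i))) = fpot u (face_of (inr i)).
  have := face_divergence planarG (fpot u) (bdv G i); rewrite big1 ?add0r.
    by rewrite bdv_pred1 => /eqP; rewrite subr_eq0 => /eqP.
  move=> [e b] _ /=; apply: oppr_inj; rewrite -(half_cauchy_riemann uE c0i).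
  by rewrite !hz subrr mulr0 oppr0.
have gz f : fpot u f = 0.
  apply: (sphere_face_connected planarG (i0 := i0) (j := i0) (g := gg) _ (Some f)).
  case=> [[e|i]|[]].
  - by apply: oppr_inj; rewrite -cr Dh mulr0 oppr0.
  - by rewrite /cobd /= gleg subrr.
  - by rewrite /cobd /= g0 subrr.
  by rewrite /cobd /= g0 subrr.
have wz p : u (inr p) = 0.
  by case: p => t; apply: oppr_inj; rewrite oppr0; [exact: hz|exact: gz].
case=> [c|p]; last exact: wz.
rewrite (u_black uE) // add0r big1 // => y _; by rewrite wz mulr0.
Qed.

Lemma walk_det_neq0 : \det B != 0.
Proof.
apply/negP=> /det0P[r r_neq0 rB]; case/negP: r_neq0; apply/eqP/rowP=> i.
rewrite mxE -[i]enum_valK.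
apply: (@resolvent_kernel (fun v => r ord0 (enum_rank v))) => v.
rewrite -(sum_walk_mx (fun v => r ord0 (enum_rank v))).
have := congr1 (fun A : 'rV[R]_#|vert T| => A ord0 (enum_rank v)) rB.
rewrite mxE [RHS]mxE => rB0; rewrite -[RHS]rB0.
by apply: eq_bigr => k _; rewrite enum_valK.
Qed.

Lemma resolvent_row c v : let u v := invmx B (enum_rank (bd c)) (enum_rank v) in
  u v - \sum_(y | head y == v) u (tail y) * (sg y * wt y) = (bd c == v)%:R.
Proof.
move=> u; rewrite -(sum_walk_mx u).
have /matrixP/(_ (enum_rank (bd c)) (enum_rank v)) : invmx B *m B = 1%:M.
  by rewrite mulVmx // unitmxE unitfE walk_det_neq0.
rewrite mxE [RHS]mxE (inj_eq enum_rank_inj) => <-.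
by apply: eq_bigr => k _; rewrite /u enum_valK.
Qed.

Lemma arcs_const (a : 'I_n -> R) :
  (forall i, a i = a (ord_pred i)) -> forall i, a i = a i0.
Proof.
move=> aE i; move: {2}(val i) (erefl (val i)) => k.
elim: k i => [|k IHk] i ik; first by congr a; apply: ord_inj; rewrite i0E.
rewrite aE; apply: IHk; rewrite [LHS]val_ord_pred ?ik //.
Qed.

(** * Rows of the boundary measurement matrix *)

Section Rows.
Variables (x S : 'M[R]_n).
Hypothesis x_response : response_matrix w x.
Hypothesis S_x : forall r k : 'I_n, x r k = S k r - S k (ord_pred r).

(** The current at the i-th boundary vertex is the drop of [fpot] across it and, by the response
    matrix, the variation of the sums of S k i h_k. Hence [a] has the same value on all arcs; this
    constant yields the coefficient of the first row of [M_mx]. *)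
Lemma potential_conserved u c0 :
  (forall v, u v - \sum_(y | head y == v) u (tail y) * (sg y * wt y) = c0 v) ->
  (forall v, interior v -> c0 v = 0) ->
  exists t, forall i : 'I_n,
    fpot u (face_of (inr i)) = t - \sum_k S k i * vpot u (bdv G k).
Proof.
move=> uE c0i; pose a i := fpot u (face_of (inr i)) + \sum_k S k i * vpot u (bdv G k).
have harm : harmonic w (vpot u).
  move=> v iv; rewrite (current_vpot uE c0i) big1 // => i /eqP iv'.
  by case/negP: iv; rewrite -iv' codom_f.
have aE i : a i = a (ord_pred i).
  have := x_response harm i; rewrite (current_vpot uE c0i) bdv_pred1.
  under [RHS]eq_bigr => k _ do rewrite S_x mulrBl.
  rewrite sumrB => /eqP; rewrite subr_eq => /eqP E0.
  by rewrite /a E0; ring.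
exists (a i0) => i; rewrite -(arcs_const aE i) /a; ring.
Qed.

(** The parity of the number of sources in between changes form when c passes j, and [path_sign]
    jumps at the same place. Their product separates into a factor of j, which is the entry of
    [D_mx], and a factor of c. *)
Lemma between_sign (c : 'I_(n.*2)) (j : 'I_n) : j != i0 -> c \in sources O ->
  (-1) ^+ #|[set k in sources O | (minn c (double_ord j true) < k
                                   < maxn c (double_ord j true))%N]|
    * (path_sign c j)%:~R
  = (-1) ^+ j * (if odd c then 1 else - (-1) ^+ c./2) :> R.
Proof.
move=> nj; rewrite O_sources => cO.
have j_gt0 : (0 < j)%N.
  by rewrite lt0n; apply: contraNneq nj => j0; apply/eqP/ord_inj; rewrite j0 i0E.
have jn := ltn_ord j; have cn := ltn_ord c.
set A := [set k in _ | _].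
have AE a b : (forall k : 'I_(n.*2), (k \in A) = ~~ odd k && (a.*2 <= k < b.*2)%N) ->
    (a <= b <= n)%N -> #|A| = (b - a)%N.
  by move=> kA ab; rewrite -(card_evens ab); apply: eq_card => k; rewrite kA inE.
have inA (k : 'I_(n.*2)) : (k \in A) = (~~ odd k || (k == 1%N :> nat)) &&
    ((minn c j.*2.+1 < k < maxn c j.*2.+1)%N) by rewrite !inE.
move: cO; rewrite inE /= => cO.
rewrite /path_sign; case oc: (odd c) => /=.
  rewrite (AE 1%N j.+1); [|move=> k; rewrite inA; lia|lia].
  by rewrite subn1 mulr1.
case: (posnP c./2) => [c0|c_gt0] /=.
  have A1 : (1 < n.*2)%N by lia.
  (* Seen from label 1, the source with label 2 lies in between, besides the j odd labels 3, ...,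
     2j+1. *)
  rewrite (cardsD1 (Ordinal A1)).
  have -> : Ordinal A1 \in A by rewrite inA /=; lia.
  have -> : #|A :\ Ordinal A1| = j.
    transitivity (j.+1 - 1)%N; last by rewrite subn1.
    rewrite -(@card_evens n 1 j.+1); last lia.
    apply: eq_card => k; rewrite in_setD1 inA inE -val_eqE /=; lia.
  by rewrite c0 exprS; ring.
rewrite [RHS]mulrN -exprD.
case: (leqP c./2 j) => cj /=.
  rewrite (AE c./2.+1 j.+1); [|move=> k; rewrite inA; lia|lia].
  rewrite subSS rmorphN1 mulrN1; congr (- _).
  by rewrite -signr_odd oddB // -oddD signr_odd.
rewrite (AE j.+1 c./2); [|move=> k; rewrite inA; lia|lia].
rewrite mulr1 -[RHS]mulN1r -exprS -signr_odd -[RHS]signr_odd; congr (_ ^+ _).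
by congr (nat_of_bool _); lia.
Qed.

Lemma pn_row r : exists a : 'rV_(1 + n),
  row r (pn_matrix w O) = a *m (M_mx S *m D_mx R n).
Proof.
pose c : 'I_(n.*2) := enum_val r.
have cO : c \in sources O := enum_valP r.
pose u v := invmx B (enum_rank (bd c)) (enum_rank v).
have uE v : u v - \sum_(y | head y == v) u (tail y) * (sg y * wt y) = (bd c == v)%:R.
  exact: resolvent_row.
have c0i v : interior v -> (bd c == v)%:R = 0 :> R.
  by case: eqP => // <-; rewrite /interior codom_f.
have c0E c' : (bd c == bd c') = (c == c') by apply/eqP/eqP => [[]|->].
have c0s c' : c' \notin sources O -> (bd c == bd c')%:R = 0 :> R.
  by rewrite c0E; case: eqP => // <-; rewrite cO.
have [t tE] := potential_conserved uE c0i.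
have vE k : vpot u (bdv G k) = (c == double_ord k false)%:R.
  rewrite (vpot_bd uE c0i) (@u_source u _ uE k true) ?c0E //.
  by rewrite (O_boundary i0E O_sources).
have fE j : fpot u (face_of (inr j)) = u (bd (double_ord j true)).
  exact: (fpot_bd uE c0i c0s).
have f0 : u (bd (double_ord i0 true)) = (c == double_ord i0 true)%:R.
  rewrite (@u_source u _ uE i0 false) ?c0E //.
  by rewrite (O_boundary i0E O_sources) eqxx.
(* The factor of [between_sign] that depends on the source only. *)
pose ep : R := if odd c then 1 else - (-1) ^+ c./2.
(* The potential is zero at the k-th boundary vertex unless c is its label, and in that case [ep] is
   - (-1)^k. *)
have epE k : (-1) ^+ (k : 'I_n) * vpot u (bdv G k) = - ep * vpot u (bdv G k).
  rewrite vE; case: eqP => [ck|_]; last by rewrite !mulr0.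
  by rewrite /ep ck /= odd_double doubleK opprK.
(* By [epE] this combination has the entry ep (t - sum of S k j h_k), that is ep times [fpot], in
   the column of the j-th face; the powers of -1 cancel those of [D_mx] in the columns of the
   boundary vertices. *)
exists (row_mx (ep * t)%:M (\row_k ((-1) ^+ k * vpot u (bdv G k)))).
apply/rowP=> c'; rewrite mxE [LHS]mxE -/c.
rewrite mulmxA /M_mx mul_row_col mul_scalar_mx /D_mx mul_mx_diag !mxE.
pose j := half_ord c'.
have rE : \sum_k ((\row_k0 ((-1) ^+ k0 * vpot u (bdv G k0))) ord0 k) *
     (\matrix_(k0, c1) (if odd c1 then S k0 (half_ord c1) else (half_ord c1 == k0)%:R)) k c'
   = - ep * (\sum_k (if odd c' then S k j else (j == k)%:R) * vpot u (bdv G k)).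
  rewrite mulr_sumr; apply: eq_bigr => k _; rewrite !mxE epE -mulrA; congr (_ * _); exact: mulrC.
rewrite rE; case oc': (odd c').
  have c'E : c' = double_ord j true by apply: ord_inj => /=; lia.
  have -> : ep * t * true%:R + - ep * (\sum_k S k j * vpot u (bdv G k)) =
      ep * fpot u (face_of (inr j)) by rewrite tE mulr1; ring.
  rewrite fE -c'E; case: ifP => [c's|/negbT c's].
    have j0 : j = i0.
      apply: ord_inj; rewrite i0E; move: c's; rewrite O_sources inE /= oc' /= => /eqP c'1.
      by rewrite c'1.
    rewrite c'E j0 f0 -j0 -c'E eq_sym; case: eqP => [cc'|_]; last by rewrite mulr0 mul0r.
    have -> : c'./2 = 0%N by have := congr1 val j0; rewrite /= i0E.
    by rewrite /ep cc' oc' expr0 !mulr1.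
  have nj : j != i0.
    by apply: contraNneq c's => j0; rewrite O_sources inE c'E j0 /= i0E.
  rewrite (@boundary_measurementE _ _ _ _ _ sg _ _ (path_sign c j)%:~R) //; first last.
  - exact: walk_det_neq0.
  - by move=> p; rewrite c'E; apply: wind_sign.
  rewrite -/(u _) mulrA {1 2}c'E between_sign // -/ep.
  have -> : c'./2 = j by [].
  ring.
have c'E : c' = double_ord j false by apply: ord_inj => /=; lia.
rewrite O_sources inE oc' /= mulr0 add0r.
have -> : \sum_k (j == k)%:R * vpot u (bdv G k) = vpot u (bdv G j) by rewrite sum_delta.
rewrite -epE vE -c'E eq_sym -mulrA mulrC -mulrA -exprD.
by rewrite -signr_odd oddD addbb expr0 mulr1.
Qed.

End Rows.

End Final.

Lemma ext_bm_matrix_row_free (R : realFieldType) m (H : diskmap m)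
    (O : edge H -> bool) (w : edge H -> R) : row_free (ext_bm_matrix O w).
Proof.
apply/row_freeP; exists (\matrix_(c, r) (c == enum_val r)%:R).
apply/matrixP=> r r'; rewrite !mxE (bigD1 (enum_val r')) //= !mxE eqxx mulr1.
rewrite big1 ?addr0 => [|c /negPf ne]; last by rewrite !mxE ne mulr0.
by rewrite enum_valP /= (inj_eq enum_val_inj) eq_sym.
Qed.

Lemma card_O2_sources n : (0 < n)%N -> (n < #|O2_sources n|)%N.
Proof.
move=> n_gt0; have lt1 : (1 < n.*2)%N by lia.
have dinj : injective (fun i : 'I_n => double_ord i false) by move=> i i' /double_ord_inj[].
pose A := [set double_ord i false | i : 'I_n].
have cardA : #|A| = n by rewrite card_imset // card_ord.
have n1 : Ordinal lt1 \notin A.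
  by apply/imsetP=> -[i _ /(congr1 val)] /=; lia.
have <- : #|Ordinal lt1 |: A| = n.+1 by rewrite cardsU1 n1 cardA.
apply: subset_leq_card; apply/subsetP=> c; rewrite !inE => /predU1P[-> //|/imsetP[i _ ->]].
by rewrite /= odd_double.
Qed.

Theorem theorem3p13 (R : realFieldType) (n : nat) (n_gt0 : (0 < n)%N)
    (G : diskmap n) (G_planar : planar_disk G)
    (w : edge G -> R) (w_gt0 : forall e, 0 < w e)
    (x : 'M[R]_n) (x_response : response_matrix w x)
    (S : 'M[R]_n)
    (S_x : forall r k : 'I_n, x r k = S k r - S k (ord_pred r))
    (O : edge (temperley G) -> bool)
    (O_perfect : perfect O (@nd_white n G))
    (O_sources : sources O = O2_sources n) :
  (pn_matrix w O == M_mx S *m D_mx R n)%MS.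
Proof.
have sub : (pn_matrix w O <= M_mx S *m D_mx R n)%MS.
  apply/row_subP=> r; apply/submxP.
  exact: (pn_row G_planar (i0 := Ordinal n_gt0) erefl O_perfect O_sources w_gt0 x_response S_x).
(* The boundary measurement matrix has full row rank, at least n + 1, and the product has n + 1
   rows, so the inclusion of row spaces is an equality. *)
rewrite -(geq_leqif (mxrank_leqif_eq sub)).
have /eqP -> := ext_bm_matrix_row_free O (pn_weight w O).
rewrite O_sources; apply: leq_trans (card_O2_sources n_gt0).
exact: rank_leq_row.
Qed.
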